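(* For any integer $k\ge2$, every directed graph whose underlying undirected graph is $\lceil\tfrac{6k}{k-1}\rceil$-edge-connected has a $\mathbb{Z}_{2k+1}$-antisymmetric flow.
   Context: Graphs are finite and may have multiple edges but no loops. For an abelian group $B$ and a directed graph $\vec G=(V,\vec E)$, a $B$-flow is a map $f:\vec E\to B$ such that for every vertex $v$, the sum of $f$ over arcs leaving $v$ minus the sum of $f$ over arcs entering $v$ equals $0$ in $B$. A $B$-flow $f$ is antisymmetric if no two arcs (not necessarily distinct) receive mutually inverse elements, i.e. there are no arcs $\vec e,\vec e'$ with $f(\vec e)=-f(\vec e')$; in particular $0\notin f(\vec E)$. *)

(* Defs.v *)
From mathcomp Require Import all_boot all_order all_algebra.
Set Implicit Arguments. Unset Strict Implicit. Unset Printing Implicit Defensive.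
Import GRing.Theory.
Local Open Scope ring_scope.

(* A finite directed multigraph without loops: vertex type V, arc type E,
   each arc e goes from [tail e] to [head e], with [tail e != head e]. *)

Definition adj_minus (V E : finType) (tail head : E -> V) (F : {set E}) : rel V :=
  fun x y => [exists e, (e \notin F) &&
      (((tail e == x) && (head e == y)) || ((tail e == y) && (head e == x)))].

Definition und_connected (V E : finType) (tail head : E -> V) (F : {set E}) : Prop :=
  forall x y : V, connect (adj_minus tail head F) x y.

Definition edge_connected (V E : finType) (tail head : E -> V) (lambda : nat) : Prop :=
  forall F : {set E}, (#|F| < lambda)%N -> und_connected tail head F.

Definition is_flow (V E : finType) (tail head : E -> V) (B : zmodType) (f : E -> B) : Prop :=
  forall v : V, \sum_(e | tail e == v) f e - \sum_(e | head e == v) f e = 0.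

Definition antisym_flow (E : finType) (B : zmodType) (f : E -> B) : Prop :=
  forall e e' : E, f e <> - f e'.

Definition ceil_div (m n : nat) : nat := ((m + n - 1) %/ n)%N.

(* Main.v *)
(** Replace every arc by k - 1 parallel edges. All cuts now have size at least 6k, so by the
theorem of Lovasz, Thomassen, Wu and Zhang on modulo (2k+1)-orientations the edges can be
oriented with outdegree minus indegree prescribed modulo 2k+1 at each vertex. On an arc, the
signed count of the k - 1 copies runs through -(k-1), -(k-3), ..., k-1; adding k + 1 gives a
value in {2, 4, ..., 2k}, a set which contains no two elements of sum 0 modulo 2k+1. The
prescription that turns these values into a flow is -(k+1) (outdegree - indegree).

The orientation theorem is proved with m = 2k+1 and targets s modulo 2m, so that parity is
included. Write ||.|| for the distance to 2mZ, and let z0 be a special vertex whose edges are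
oriented in advance, with deg z0 <= 2m - 2 + ||s(z0)||, while d(A) >= 2m - 2 + ||s(A)|| for
every set A of other vertices, other than the set of all of them, and with the possible
exception of a single vertex of target 0. A tight set with at least two vertices is
contracted, and its inside is then solved with the outside in the role of z0. Otherwise all
larger cuts have slack 2, which allows one edge to be oriented and deleted, or a pair of edges
to be lifted. A vertex of target 0 is lifted away. If there is none, the remaining stuck
configuration has deg z0 = 2m - 1, all edges at z0 having the same direction and all other
vertices targets of the same sign. There the addition of m - 1 edges at z0 of the opposite
direction, all with the same end y, preserves the hypotheses and shifts the target of y by
about m, which lets an edge at y be deleted. *)

Require Import Defs.
From mathcomp Require Import all_boot all_order all_algebra.
From mathcomp Require Import zify ring lra.
Set Implicit Arguments. Unset Strict Implicit. Unset Printing Implicit Defensive.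
Import Order.TTheory GRing.Theory Num.Theory.
Local Open Scope ring_scope.

(** * Distance to the multiples of 2m *)

Definition nrm (m : nat) (x : int) : int :=
  Num.min (x %% (2 * m)%N%:Z)%Z ((2 * m)%N%:Z - (x %% (2 * m)%N%:Z)%Z).

Section Norm.
Variable m : nat.
Hypothesis m_gt0 : (0 < m)%N.

(** Balanced remainder. Together with [nrm_uniq] it turns facts about [nrm] into linear arithmetic
    in [t]. *)
Lemma nrm_rep (x : int) :
  exists c t : int, [/\ x = c * (2 * m)%N%:Z + t, - m%:Z < t, t <= m%:Z & nrm m x = `|t|].
Proof.
have N0 : (2 * m)%N%:Z != 0 by lia.
have r0 := modz_ge0 x N0; have r1 := ltz_mod x N0.
have xE := divz_eq x (2 * m)%N%:Z.
rewrite /nrm; move: r0 r1 xE; set r := (x %% _)%Z; set c := (x %/ _)%Z => r0 r1 xE.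
case: (lerP r m%:Z) => rm.
  by exists c, r; split; lia.
by exists (c + 1), (r - (2 * m)%N%:Z); split; [rewrite mulrDl; lia | lia | lia | lia].
Qed.

Lemma nrm_uniq (c t : int) : `|t| <= m%:Z -> nrm m (c * (2 * m)%N%:Z + t) = `|t|.
Proof.
move=> tm; have [c' [t' [E t1 t2 ->]]] := nrm_rep (c * (2 * m)%N%:Z + t).
have : (c - c') * (2 * m)%N%:Z = t' - t by rewrite mulrBl; lia.
move: (c - c') => d dE.
have : d = 0 \/ d = 1 \/ d = -1 by nia.
by case=> [|[]] dd; subst d; lia.
Qed.

Lemma nrm_ge0 x : 0 <= nrm m x.
Proof. by have [c [t [_ _ _ ->]]] := nrm_rep x. Qed.

Lemma nrm_le x : nrm m x <= m%:Z.
Proof. by have [c [t [_ ? ? ->]]] := nrm_rep x; lia. Qed.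

Lemma nrm_congr x y : ((2 * m)%N%:Z %| x - y)%Z -> nrm m x = nrm m y.
Proof.
move=> /dvdzP[d E]; have [c [t [yE ? ? ->]]] := nrm_rep y.
have -> : x = (d + c) * (2 * m)%N%:Z + t by rewrite mulrDl -E yE; ring.
by rewrite nrm_uniq; lia.
Qed.

Lemma nrmN x : nrm m (- x) = nrm m x.
Proof.
have [c [t [-> ? ? ->]]] := nrm_rep x.
have -> : - (c * (2 * m)%N%:Z + t) = (- c) * (2 * m)%N%:Z + (- t) by ring.
by rewrite nrm_uniq; lia.
Qed.

Lemma nrmD_le x y : nrm m (x + y) <= nrm m x + `|y|.
Proof.
have [c [t [-> ? ? ->]]] := nrm_rep x; rewrite -addrA.
case: (lerP `|t + y| m%:Z) => ty; first by rewrite nrm_uniq //; lia.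
by apply: le_trans (nrm_le _) _; lia.
Qed.

Lemma nrm_parity x : (2 %| x - nrm m x)%Z.
Proof.
have [c [t [-> ? ? ->]]] := nrm_rep x.
have -> : (2 * m)%N%:Z = m%:Z * 2 by lia.
by rewrite mulrA; lia.
Qed.

Lemma nrm_eq0 x : (nrm m x == 0) = ((2 * m)%N%:Z %| x)%Z.
Proof.
apply/eqP/idP => [|/dvdzP[c ->]]; last first.
  by rewrite -[c * _]addr0 nrm_uniq ?normr0.
have [c [t [-> ? ? ->]]] := nrm_rep x => t0.
have -> : t = 0 by lia.
by rewrite addr0 dvdz_mull.
Qed.

Lemma nrm_half (eps x : int) : `|eps| = 1 -> nrm m (x + eps * m%:Z) = m%:Z - nrm m x.
Proof.
move=> e1; have [c [t [-> ? ? ->]]] := nrm_rep x.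
have {e1} : eps = 1 \/ eps = -1 by lia.
case: (lerP t 0) => t0; case=> ->.
- have -> : c * (2 * m)%N%:Z + t + 1 * m%:Z = c * (2 * m)%N%:Z + (t + m%:Z) by ring.
  by rewrite nrm_uniq; lia.
- have -> : c * (2 * m)%N%:Z + t + -1 * m%:Z = (c - 1) * (2 * m)%N%:Z + (t + m%:Z) by rewrite PoszM; ring.
  by rewrite nrm_uniq; lia.
- have -> : c * (2 * m)%N%:Z + t + 1 * m%:Z = (c + 1) * (2 * m)%N%:Z + (t - m%:Z) by rewrite PoszM; ring.
  by rewrite nrm_uniq; lia.
- have -> : c * (2 * m)%N%:Z + t + -1 * m%:Z = c * (2 * m)%N%:Z + (t - m%:Z) by ring.
  by rewrite nrm_uniq; lia.
Qed.

(** A direction that leads towards 2mZ plays the part of the sign of a target. *)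
Lemma nrm_step x : nrm m x != 0 ->
  nrm m (x - 1) = nrm m x - 1 \/ nrm m (x + 1) = nrm m x - 1.
Proof.
have [c [t [-> ? ? ->]]] := nrm_rep x => t0.
case: (lerP t 0) => ts; [right|left].
  by rewrite -addrA nrm_uniq; lia.
by rewrite -addrA nrm_uniq; lia.
Qed.
End Norm.

(** * Distributing an integer of bounded size and given parity over several summands *)

Lemma split_step (c S t : int) : 0 <= c -> 0 <= S -> `|t| <= c + S -> (2 %| t - (c + S))%Z ->
  exists x : int, [/\ `|x| <= c, (2 %| x - c)%Z & `|t - x| <= S].
Proof.
(* The largest value [x = c] is taken, unless less than [- S] would be left over; then [x = t + S]
   leaves exactly [- S]. *)
move=> c0 S0 tS tp; case: (lerP (t - c) (- S)) => h1.
  by exists (t + S); split; lia.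
by exists c; split; lia.
Qed.

(** Greedy choice by [split_step], one index at a time. It serves to distribute the net flow between
    a contracted set and an outside vertex over the members of the set. *)
Lemma split_target (I : finType) (A : {set I}) (c : I -> int) (t : int) :
  (forall i, i \in A -> 0 <= c i) -> `|t| <= \sum_(i in A) c i ->
  (2 %| t - \sum_(i in A) c i)%Z ->
  exists h : I -> int, [/\ forall i, i \in A -> `|h i| <= c i,
    forall i, i \in A -> (2 %| h i - c i)%Z & \sum_(i in A) h i = t].
Proof.
have [n] := ubnP #|A|; elim: n A t => // n IHn A t.
have [->|[i iA]] := set_0Vmem A.
  move=> _ _; rewrite big_set0 => t0 _; exists (fun _ => 0).
  by split=> [i|i|]; rewrite ?inE // big_set0; lia.
rewrite (cardsD1 i) iA ltnS => cA c0; rewrite (big_setD1 i) //= => tS tp.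
have ci := c0 i iA.
have S0 : 0 <= \sum_(j in A :\ i) c j.
  by apply: sumr_ge0 => j; rewrite !inE => /andP[_ /c0].
set S := \sum_(j in A :\ i) c j in tS tp S0.
have [x [x1 x2 x3]] := split_step ci S0 tS tp.
have [] := IHn (A :\ i) (t - x).
- by lia.
- by move=> j; rewrite !inE => /andP[_ /c0].
- by [].
- by rewrite -/S; lia.
move=> h [h1 h2 h3]; exists (fun j => if j == i then x else h j); split.
- move=> j jA; case: eqP => [->//|/eqP ji]; by apply: h1; rewrite !inE ji.
- move=> j jA; case: eqP => [->//|/eqP ji]; by apply: h2; rewrite !inE ji.
rewrite (big_setD1 i) //= eqxx.
rewrite (eq_bigr h) ?h3 => [|j]; first by lia.
by rewrite !inE => /andP[/negbTE->].
Qed.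

(** * Multigraphs as multiplicity functions, orientations as net flows *)

Section Orient.
Variable V : finType.
Implicit Types (x y u v w a b : V) (A U : {set V}) (e f g : V -> V -> int).

Definition ind x a : int := (a == x)%:Z.
Definition edge_ind x y a b : int := ind x a * ind y b + ind y a * ind x b.
Definition arc_ind x y a b : int := ind x a * ind y b - ind y a * ind x b.

Lemma sum_ind x A : \sum_(a in A) ind x a = (x \in A)%:Z.
Proof.
case: (boolP (x \in A)) => xA.
  rewrite (big_setD1 x) //= /ind eqxx big1 ?addr0 // => a.
  by rewrite !inE => /andP[/negbTE->].
by rewrite big1 // => a aA; rewrite /ind; case: eqP aA xA => // -> ->.
Qed.

Lemma sum_edge x y a A :
  \sum_(b in A) edge_ind x y a b = ind x a * (y \in A)%:Z + ind y a * (x \in A)%:Z.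
Proof. by rewrite big_split /= -!mulr_sumr !sum_ind. Qed.

Lemma sum_arc x y a A :
  \sum_(b in A) arc_ind x y a b = ind x a * (y \in A)%:Z - ind y a * (x \in A)%:Z.
Proof. by rewrite sumrB -!mulr_sumr !sum_ind. Qed.

Lemma sum2_edge x y A U : \sum_(a in A) \sum_(b in U) edge_ind x y a b =
  (x \in A)%:Z * (y \in U)%:Z + (y \in A)%:Z * (x \in U)%:Z.
Proof.
under eq_bigr do rewrite sum_edge.
by rewrite big_split /= -!mulr_suml !sum_ind.
Qed.

Lemma edgeC x y a b : edge_ind x y a b = edge_ind x y b a.
Proof. by rewrite /edge_ind addrC mulrC [ind x a * _]mulrC. Qed.

Lemma arcC x y a b : arc_ind x y b a = - arc_ind x y a b.
Proof. by rewrite /arc_ind opprB mulrC [ind y b * _]mulrC. Qed.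

Lemma edge_diag x y a : x != y -> edge_ind x y a a = 0.
Proof.
by move=> xy; rewrite /edge_ind /ind; have [->|_] := eqVneq a x; rewrite ?(negbTE xy); lia.
Qed.

Lemma edge_arc x y a b : x != y ->
  (edge_ind x y a b = 0 /\ arc_ind x y a b = 0) \/
  (edge_ind x y a b = 1 /\ (arc_ind x y a b = 1 \/ arc_ind x y a b = -1)).
Proof.
rewrite /edge_ind /arc_ind /ind => xy.
have [->|ax] := eqVneq a x; have [->|bx] := eqVneq b x; rewrite ?eqxx ?(negbTE xy);
  rewrite ?[y == x]eq_sym ?(negbTE xy); do ?case: eqP => _; lia.
Qed.

Lemma arc_le x y a b : x != y -> `|arc_ind x y a b| <= edge_ind x y a b.
Proof. by move=> /(edge_arc a b)[[-> ->]|[-> [->|->]]]. Qed.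

Lemma arc_parity x y a b : x != y -> (2 %| arc_ind x y a b - edge_ind x y a b)%Z.
Proof. by move=> /(edge_arc a b)[[-> ->]|[-> [->|->]]]. Qed.

Lemma sign_parity (eps z : int) : `|eps| = 1 -> (2 %| eps * z - z)%Z.
Proof.
move=> eps1; have [->|->] : eps = 1 \/ eps = -1 by lia.
  by rewrite mul1r subrr dvdz0.
by apply/dvdzP; exists (- z); ring.
Qed.

(** [g x y] is the number of edges directed from [x] to [y] minus the number directed back. With
    [e x y] parallel edges the possible values are exactly the integers of absolute value at most
    [e x y] and of the same parity, so single edges need no names. *)
Definition orientable (N : int) U e (r : V -> int) := exists g,
  [/\ forall x y, g y x = - g x y,
      forall x y, x \in U -> y \in U -> `|g x y| <= e x y,
      forall x y, x \in U -> y \in U -> (2 %| g x y - e x y)%Z &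
      forall v, v \in U -> (N %| \sum_(y in U) g v y - r v)%Z].

(** The deleted edge is put back, directed from [x] to [y] if [eps] is 1 and from [y] to [x] if it
    is -1. *)
Lemma orientable_del (N eps : int) U e x y (r r' : V -> int) :
  `|eps| = 1 -> x != y -> x \in U -> y \in U ->
  (forall v, v \in U -> (N %| r v - r' v - eps * (ind x v - ind y v))%Z) ->
  orientable N U (fun a b => e a b - edge_ind x y a b) r' -> orientable N U e r.
Proof.
move=> eps1 xy xU yU rr' [g [gA gB gP gS]].
exists (fun a b => g a b + eps * arc_ind x y a b); split.
- by move=> a b; rewrite gA arcC mulrN opprD.
- move=> a b aU bU; apply: le_trans (ler_normD _ _) _; rewrite normrM eps1 mul1r.
  have := gB a b aU bU; have := arc_le a b xy; lra.
- move=> a b aU bU.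
  have -> : g a b + eps * arc_ind x y a b - e a b = (g a b - (e a b - edge_ind x y a b)) +
    (eps * arc_ind x y a b - arc_ind x y a b) + (arc_ind x y a b - edge_ind x y a b) by ring.
  by apply: rpredD; [apply: rpredD; [exact: gP|exact: sign_parity]|exact: arc_parity].
move=> v vU; rewrite big_split /= -mulr_sumr sum_arc xU yU !mulr1.
have -> : \sum_(b in U) g v b + eps * (ind x v - ind y v) - r v =
  (\sum_(b in U) g v b - r' v) - (r v - r' v - eps * (ind x v - ind y v)) by ring.
by apply: rpredB; [exact: gS | exact: rr'].
Qed.

(** One directed edge between [u] and [w] is replaced by the path through [v] in the same direction,
    which changes no difference of outdegree and indegree. *)
Lemma orientable_lift (N : int) U e u v w (r : V -> int) :
  u != v -> v != w -> u != w -> u \in U -> v \in U -> w \in U -> 0 <= e u w ->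
  e w u = e u w ->
  orientable N U (fun a b => e a b + (edge_ind u w a b - edge_ind u v a b - edge_ind v w a b)) r ->
  orientable N U e r.
Proof.
move=> uv vw uw uU vU wU euw ewu [g [gA gB gP gS]].
(* A direction that occurs among the edges between [u] and [w], of which the lifted graph has
   [e u w + 1]. If [g u w] is 0, this number is even and positive, so both directions occur. *)
have [eps [eps1 epsB]] : exists eps : int, `|eps| = 1 /\ `|g u w - eps| <= e u w.
  have := gB u w uU wU; have := gP u w uU wU.
  rewrite /edge_ind /ind !eqxx ![w == u]eq_sym ![w == v]eq_sym (negbTE uw) (negbTE uv) (negbTE vw) /=.
  move=> h1 h2; case: (lerP (g u w) 0) => h3; [exists (-1)|exists 1]; split; auto; lia.
exists (fun a b => g a b + eps * (arc_ind u v a b + arc_ind v w a b - arc_ind u w a b)); split.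
- by move=> a b; rewrite gA (arcC u v a b) (arcC v w a b) (arcC u w a b); ring.
- move=> a b aU bU; have := gB a b aU bU; have := gA u w.
  have uwE : [/\ edge_ind u v u w = 0, edge_ind v w u w = 0, arc_ind u v u w = 0, arc_ind v w u w = 0 & arc_ind u w u w = 1].
    by rewrite /edge_ind /arc_ind /ind !eqxx (negbTE uv) ![w == _]eq_sym (negbTE vw) (negbTE uw).
  have [E1 E2 A1 A2 A3] := uwE.
  have [/andP[/eqP-> /eqP->] _ _|nuw] := boolP ((a == u) && (b == w)).
    by rewrite A1 A2 A3 !add0r mulrN1.
  have [/andP[/eqP-> /eqP->] -> _|nwu] := boolP ((a == w) && (b == u)).
    rewrite (arcC u v) (arcC v w) (arcC u w) A1 A2 A3 oppr0 !add0r opprK mulr1 ewu.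
    by rewrite addrC -opprB normrN.
  have [-> ->] : edge_ind u w a b = 0 /\ arc_ind u w a b = 0.
    move: nuw nwu; rewrite /edge_ind /arc_ind /ind.
    by case: (a == u); case: (b == w); case: (a == w); case: (b == u) => //= _ _; rewrite ?mulr0 ?mul0r.
  rewrite subr0 add0r => _ h; apply: le_trans (ler_normD _ _) _.
  rewrite normrM eps1 mul1r; have := ler_normD (arc_ind u v a b) (arc_ind v w a b).
  have := arc_le a b uv; have := arc_le a b vw; lra.
- move=> a b aU bU.
  set S := arc_ind u v a b + arc_ind v w a b - arc_ind u w a b.
  have -> : g a b + eps * S - e a b =
    (g a b - (e a b + (edge_ind u w a b - edge_ind u v a b - edge_ind v w a b))) + (eps * S - S) +
    (arc_ind u v a b - edge_ind u v a b) + (arc_ind v w a b - edge_ind v w a b) -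
    (arc_ind u w a b - edge_ind u w a b) by rewrite /S; ring.
  apply: rpredB; last exact: arc_parity.
  apply: rpredD; last exact: arc_parity.
  apply: rpredD; last exact: arc_parity.
  by apply: rpredD; [exact: gP|exact: sign_parity].
move=> x xU; have := gS x xU; rewrite big_split /= -mulr_sumr sumrB big_split /= !sum_arc uU vU wU.
set S := \sum_(b in U) g x b; congr (_ %| _)%Z; ring.
Qed.

End Orient.

(** * Removing a vertex and contracting a set of vertices *)

Section Contract.
Variable V : finType.
Implicit Types (x y u v w a b : V) (A U : {set V}) (e f g h : V -> V -> int).

Lemma orientable_congr N U e (r r' : V -> int) :
  (forall v, v \in U -> (N %| r' v - r v)%Z) -> orientable N U e r' -> orientable N U e r.
Proof.
move=> rr [g [gA gB gP gS]]; exists g; split=> // v vU.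
have -> : \sum_(y in U) g v y - r v = (\sum_(y in U) g v y - r' v) + (r' v - r v) by ring.
by apply: rpredD; [exact: gS | exact: rr].
Qed.

(** Of the edges between [v] and any other vertex, half are directed each way, so their net flow is
    0. *)
Lemma orientable_remove N U e (r : V -> int) v :
  v \in U -> (forall x y, e x y = e y x) -> (forall y, y \in U -> 0 <= e v y) ->
  (forall y, y \in U -> (2 %| e v y)%Z) -> (N %| r v)%Z ->
  orientable N (U :\ v) e r -> orientable N U e r.
Proof.
move=> vU eC e0 e2 rv [g [gA gB gP gS]].
exists (fun x y => if (x == v) || (y == v) then 0 else g x y); split.
- by move=> x y; rewrite orbC; case: ifP; rewrite ?oppr0.
- move=> x y xU yU; case: eqVneq => [->|xv] /=; first by rewrite normr0 e0.
  case: eqVneq => [->|yv]; first by rewrite normr0 eC e0.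
  by apply: gB; rewrite !inE ?xv ?yv.
- move=> x y xU yU; case: eqVneq => [->|xv] /=; first by rewrite sub0r rpredN e2.
  case: eqVneq => [->|yv]; first by rewrite sub0r rpredN eC e2.
  by apply: gP; rewrite !inE ?xv ?yv.
move=> x xU; have [->|xv] := eqVneq x v.
  by rewrite big1 ?sub0r ?rpredN // => y _; rewrite eqxx.
rewrite (big_setD1 v vU) /= eqxx add0r (eq_bigr (g x)).
  by apply: gS; rewrite !inE xv.
by move=> y; rewrite !inE => /andP[/negbTE-> _]; rewrite ?(negbTE xv).
Qed.

(** The vertex [a] stands for all of [A]; edges inside [A] would become loops and are dropped. *)
Definition contract_mul A a e x y : int :=
  if x == a then (if y == a then 0 else \sum_(b in A) e b y)
  else if y == a then \sum_(b in A) e x b else e x y.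

Definition contract_fun A a (r : V -> int) x : int :=
  if x == a then \sum_(b in A) r b else r x.

(** An orientation of the contracted graph fixes the net flow between [A] and each outside vertex.
    It is distributed over the vertices of [A] as [h], the inside of [A] is oriented with targets
    corrected by [h], and the pieces are glued. *)
Lemma orientable_contract N U A a e (r : V -> int) :
  A \subset U -> a \in A -> (forall x y, e x y = e y x) -> (forall x y, 0 <= e x y) ->
  orientable N (a |: U :\: A) (contract_mul A a e) (contract_fun A a r) ->
  (forall h, (forall v x, v \in A -> x \in U :\: A -> `|h v x| <= e v x) ->
     (forall v x, v \in A -> x \in U :\: A -> (2 %| h v x - e v x)%Z) ->
     (N %| \sum_(v in A) (r v - \sum_(x in U :\: A) h v x))%Z ->
     orientable N A e (fun v => r v - \sum_(x in U :\: A) h v x)) ->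
  orientable N U e r.
Proof.
move=> AU aA eC e0 [g1 [gA gB gP gS]] phase2.
have outP x : x \in U :\: A -> [/\ x \in U, x \notin A, x != a & x \in a |: U :\: A].
  rewrite !inE => /andP[xA ->]; rewrite xA orbT; split=> //.
  by apply: contraNneq xA => ->.
have aU1 : a \in a |: U :\: A by rewrite !inE eqxx.
have : forall x, exists hx : V -> int, x \in U :\: A ->
    [/\ forall v, v \in A -> `|hx v| <= e v x,
        forall v, v \in A -> (2 %| hx v - e v x)%Z & \sum_(v in A) hx v = g1 a x].
  move=> x; case: (boolP (x \in U :\: A)) => [xo|_]; last by exists (fun _ => 0).
  have [xU xA xa xU1] := outP x xo.
  have := gB a x aU1 xU1; have := gP a x aU1 xU1.
  rewrite /contract_mul eqxx (negbTE xa) => gp gb.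
  have [hx [h1 h2 h3]] := split_target (c := fun v => e v x) (fun v _ => e0 v x) gb gp.
  by exists hx.
move=> /fin_all_exists[hh hhP]; pose h v x := hh x v.
have h1 v x : v \in A -> x \in U :\: A -> `|h v x| <= e v x.
  by move=> vA xo; have [H _ _] := hhP x xo; apply: H.
have h2 v x : v \in A -> x \in U :\: A -> (2 %| h v x - e v x)%Z.
  by move=> vA xo; have [_ H _] := hhP x xo; apply: H.
have h3 x : x \in U :\: A -> \sum_(v in A) h v x = g1 a x.
  by move=> xo; have [_ _ H] := hhP x xo.
have aNo : a \notin U :\: A by rewrite !inE aA.
have g1aa : g1 a a = 0 by have := gA a a; lia.
(* The divisibility demanded of [h] is the condition that [g1] satisfies at the contracted vertex
   [a]. *)
have [g2 [g2A g2B g2P g2S]] : orientable N A e (fun v => r v - \sum_(x in U :\: A) h v x).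
  apply: phase2 => //; rewrite sumrB exchange_big /=.
  rewrite [X in _ - X](eq_bigr (g1 a)) => [|x xo]; last exact: h3.
  have := gS a aU1; rewrite big_setU1 //= g1aa add0r /contract_fun eqxx.
  by rewrite -opprB rpredN.
have splitU F : \sum_(y in U) F y = \sum_(y in A) F y + \sum_(y in U :\: A) F y :> int.
  by rewrite (big_setID A) /= (setIidPr AU).
exists (fun x y => if x \in A then (if y \in A then g2 x y else h x y)
                   else if y \in A then - h y x else g1 x y).
have inA x : x \in A -> x \in U by move/(subsetP AU).
split.
- by move=> x y; case: ifP => xA; case: ifP => yA; rewrite ?opprK.
- move=> x y xU yU; case: ifP => xA; case: ifP => yA.
  + exact: g2B.
  + by apply: h1; rewrite // !inE yA.
  + by rewrite normrN eC h1 // !inE xA.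
  + have xo : x \in U :\: A by rewrite !inE xA.
    have yo : y \in U :\: A by rewrite !inE yA.
    have [_ _ xa xU1] := outP x xo; have [_ _ ya yU1] := outP y yo.
    by have := gB x y xU1 yU1; rewrite /contract_mul (negbTE xa) (negbTE ya).
- move=> x y xU yU; case: ifP => xA; case: ifP => yA.
  + exact: g2P.
  + by apply: h2; rewrite // !inE yA.
  + have -> : - h y x - e x y = - (h y x - e y x) - e y x * 2 by rewrite eC; ring.
    by apply: rpredB; [rewrite rpredN h2 // !inE xA | exact: dvdz_mull].
  + have xo : x \in U :\: A by rewrite !inE xA.
    have yo : y \in U :\: A by rewrite !inE yA.
    have [_ _ xa xU1] := outP x xo; have [_ _ ya yU1] := outP y yo.
    by have := gP x y xU1 yU1; rewrite /contract_mul (negbTE xa) (negbTE ya).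
move=> x xU; rewrite splitU; case: (boolP (x \in A)) => xA.
  under eq_bigr => y yA do rewrite yA.
  rewrite [X in _ + X - _](eq_bigr (h x)) => [|y]; last by rewrite !inE => /andP[/negbTE->].
  by have := g2S x xA; rewrite opprB addrA.
have xo : x \in U :\: A by rewrite !inE xA.
have [_ _ xa xU1] := outP x xo.
under eq_bigr => y yA do rewrite yA.
rewrite [X in _ + X - _](eq_bigr (g1 x)) => [|y]; last by rewrite !inE => /andP[/negbTE->].
rewrite sumrN h3 //; have := gS x xU1.
by rewrite big_setU1 //= /contract_fun (negbTE xa) (gA a x).
Qed.

End Contract.

(* Canonical structures may show the same big sum in convertible but syntactically different
   forms, which lia would treat as unrelated. *)
Ltac big_lia :=
  repeat match goal with H : is_true _ |- _ =>
    match type of H with context [bigop.body] => revert H end end;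
  repeat match goal with |- context [@bigop.body ?R ?I ?z ?r ?F] =>
    let t := fresh "t" in move: (@bigop.body R I z r F) => t end;
  intros; lia.

(** * Edge cuts and their parity *)

Section Cut.
Variable V : finType.
Implicit Types (x y u v w a b : V) (A U : {set V}) (e f : V -> V -> int) (al be s : V -> int).

(** The special vertex z0 always lies outside [A], so the [al x] edges from [x] to z0 are all
    cut. *)
Definition cut U e al A : int := \sum_(x in A) (\sum_(y in U :\: A) e x y + al x).

Lemma dvdz_sum (d : int) (I : finType) (P : {set I}) (F : I -> int) :
  (forall i, i \in P -> (d %| F i)%Z) -> (d %| \sum_(i in P) F i)%Z.
Proof. by move=> h; apply: rpred_sum. Qed.

Lemma sum_sym_even e A : (forall x y, e x y = e y x) -> (forall x, e x x = 0) ->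
  (2 %| \sum_(x in A) \sum_(y in A) e x y)%Z.
Proof.
move=> eC e0; have [n] := ubnP #|A|; elim: n A => // n IHn A.
have [->|[x xA]] := set_0Vmem A; first by rewrite big_set0.
rewrite (cardsD1 x) xA => cA; rewrite (big_setD1 x xA) /= (big_setD1 x xA) /= e0 add0r.
under [X in _ + X]eq_bigr => y yA do rewrite (big_setD1 x xA) /=.
rewrite big_split /= [X in _ + (X + _)](eq_bigr (e x)) => [|y _]; last exact: eC.
rewrite addrA; apply: rpredD; last by apply: IHn; lia.
by apply/dvdzP; exists (\sum_(y in A :\ x) e x y); ring.
Qed.

(** The degrees in [A] add up to the cut plus twice the number of inner edges, and each degree has
    the parity of its target. *)
Lemma cut_parity U e al s A : (forall x y, e x y = e y x) -> (forall x, e x x = 0) ->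
  (forall v, v \in U -> (2 %| s v - (\sum_(y in U) e v y + al v))%Z) -> A \subset U ->
  (2 %| cut U e al A - \sum_(v in A) s v)%Z.
Proof.
move=> eC e0 sP AU.
have h1 : (2 %| \sum_(v in A) (s v - (\sum_(y in U) e v y + al v)))%Z.
  by apply: dvdz_sum => v /(subsetP AU); apply: sP.
have h2 := sum_sym_even A eC e0.
have E : \sum_(v in A) (s v - (\sum_(y in U) e v y + al v)) =
   \sum_(v in A) s v - \sum_(x in A) \sum_(y in A) e x y - cut U e al A.
  rewrite /cut -!sumrB; apply: eq_bigr => v vA.
  by rewrite (big_setID A) /= (setIidPr AU); ring.
rewrite E in h1; move: h1 h2; set a := \sum_(v in A) s v; set b := \sum_(x in A) _.
move: (cut _ _ _ _) => c; lia.
Qed.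

Lemma cutD U e f al be A :
  cut U (fun x y => e x y + f x y) (fun x => al x + be x) A = cut U e al A + cut U f be A.
Proof.
rewrite /cut -big_split; apply: eq_bigr => x _ /=; rewrite big_split /=; ring.
Qed.

Lemma cut_edgeN U x y be A : A \subset U -> x \in U -> y \in U ->
  cut U (fun a b => - edge_ind x y a b) be A =
  - ((x \in A)%:Z * (y \notin A)%:Z + (y \in A)%:Z * (x \notin A)%:Z) + \sum_(v in A) be v.
Proof.
move=> AU xU yU; rewrite /cut big_split /=; congr (_ + _).
under eq_bigr do rewrite sumrN.
by rewrite sumrN sum2_edge !inE xU yU !andbT.
Qed.

Lemma small_set A : A != set0 -> (1 < #|A|)%N \/ exists z, A = [set z].
Proof.
rewrite -card_gt0 => A0; case: (ltnP 1 #|A|) => [|A1]; [by left | right].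
by apply/cards1P; rewrite eqn_leq A1.
Qed.

End Cut.

(** * Orientations modulo 2m *)

Section Admissible.
Variables (m : nat) (V : finType).
Hypothesis m_gt2 : (2 < m)%N.
Implicit Types (x y u v w a b : V) (A B U : {set V}) (e f g h : V -> V -> int).
Implicit Types (al be ka kp s sg F : V -> int).
Local Notation N := (2 * m)%N%:Z.
Let m_gt0 : (0 < m)%N. Proof. by lia. Qed.

(* [U] is the set of vertices other than z0, [e] gives the edge multiplicities, [al v] is the
   number of edges between v and z0, [ka v] the number of those leaving v minus the number of
   those entering v, and [s v] the target of v modulo 2m; the target of z0 is minus the sum of
   [s] over [U]. The exempt vertex [v0] counts only if it lies in [U] and has target 0. *)
Record admissible U e al ka s v0 : Prop := Admissible {
  adm_sym : forall x y, e x y = e y x;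
  adm_diag : forall x, e x x = 0;
  adm_ge0 : forall x y, 0 <= e x y;
  adm_arcs : forall v, v \in U -> `|ka v| <= al v;
  adm_arcs_parity : forall v, v \in U -> (2 %| al v - ka v)%Z;
  adm_parity : forall v, v \in U -> (2 %| s v - (\sum_(y in U) e v y + al v))%Z;
  adm_sum : (N %| \sum_(v in U) (s v - ka v))%Z;
  adm_special : \sum_(v in U) al v <= N - 2 + nrm m (\sum_(v in U) s v);
  adm_cut : forall A, A \subset U -> A != set0 -> A != U ->
    (A = [set v0] /\ nrm m (s v0) = 0) \/
    N - 2 + nrm m (\sum_(v in A) s v) <= cut U e al A }.

(** This holds as soon as no set of this kind is tight: by parity the slack is then at least 2. *)
Definition strict U e al s := forall A, A \subset U -> (1 < #|A|)%N -> A != U ->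
  N + nrm m (\sum_(v in A) s v) <= cut U e al A.

(** Twice the number of edges within [U], plus the number of vertices. Edges at z0 are not counted,
    so a step may add some. *)
Definition weight U e : int := \sum_(x in U) \sum_(y in U) e x y + #|U|%:Z.

(** The induction hypothesis, for the lexicographic order on the weight and the degree of z0. *)
Definition solved_below U e al := forall U' e' al' ka' s' v1,
  admissible U' e' al' ka' s' v1 ->
  weight U' e' < weight U e \/
    weight U' e' = weight U e /\ \sum_(v in U') al' v < \sum_(v in U) al v ->
  orientable N U' e' (fun v => s' v - ka' v).

(** * Local steps: deleting, rerouting and lifting edges *)

Lemma cut_strict U e al ka s v0 A : admissible U e al ka s v0 -> A \subset U ->
  N - 2 + nrm m (\sum_(v in A) s v) < cut U e al A ->
  N + nrm m (\sum_(v in A) s v) <= cut U e al A.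
Proof.
move=> adm AU; have := cut_parity (adm_sym adm) (adm_diag adm) (adm_parity adm) AU.
have := nrm_parity m_gt0 (\sum_(v in A) s v).
move: (\sum_(v in A) s v) (cut _ _ _ _) => a c; move: (nrm m a) => b; lia.
Qed.

(** Common frame of the local steps: [f], [be], [kp] and [sg] are the increments of [e], [al], [ka]
    and [s]. *)
Lemma admissible_update U e al ka s v0 v1 f be kp sg :
  admissible U e al ka s v0 ->
  (forall x y, f x y = f y x) -> (forall x, f x x = 0) -> (forall x y, 0 <= e x y + f x y) ->
  (forall v, v \in U -> `|ka v + kp v| <= al v + be v) ->
  (forall v, v \in U -> (2 %| be v - kp v)%Z) ->
  (forall v, v \in U -> (2 %| sg v - (\sum_(y in U) f v y + be v))%Z) ->
  (N %| \sum_(v in U) (sg v - kp v))%Z ->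
  \sum_(v in U) al v + \sum_(v in U) be v <=
     N - 2 + nrm m (\sum_(v in U) s v + \sum_(v in U) sg v) ->
  (forall A, A \subset U -> A != set0 -> A != U ->
    (A = [set v1] /\ nrm m (s v1 + sg v1) = 0) \/
    N - 2 + nrm m (\sum_(v in A) s v + \sum_(v in A) sg v) <= cut U e al A + cut U f be A) ->
  admissible U (fun x y => e x y + f x y) (fun v => al v + be v) (fun v => ka v + kp v)
    (fun v => s v + sg v) v1.
Proof.
move=> adm fC f0 ef0 kaP beP sgP sumP DP cutP; split=> //.
- by move=> x y; rewrite (adm_sym adm) fC.
- by move=> x; rewrite (adm_diag adm) f0.
- move=> v vU; have -> : al v + be v - (ka v + kp v) = (al v - ka v) + (be v - kp v) by ring.
  by apply: rpredD; [exact: adm_arcs_parity adm v vU | exact: beP].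
- move=> v vU; rewrite big_split /=.
  have -> : s v + sg v - (\sum_(y in U) e v y + \sum_(y in U) f v y + (al v + be v)) =
    (s v - (\sum_(y in U) e v y + al v)) + (sg v - (\sum_(y in U) f v y + be v)) by ring.
  by apply: rpredD; [exact: adm_parity adm v vU | exact: sgP].
- rewrite (eq_bigr (fun v => (s v - ka v) + (sg v - kp v))) => [|v _]; last by ring.
  by rewrite big_split /=; apply: rpredD; [exact: adm_sum adm | exact: sumP].
- by rewrite !big_split.
by move=> A AU A0 AnU; rewrite cutD big_split /=; apply: cutP.
Qed.

(** An edge between [x] and [y] is directed according to [eps] and deleted, while the edges at z0
    change by [be] and their net flow by [kp]. The weight falls whatever happens at z0. *)
Lemma step_edge U e al ka s v0 v1 (eps : int) x y be kp :
  solved_below U e al -> admissible U e al ka s v0 ->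
  `|eps| = 1 -> x != y -> x \in U -> y \in U -> 0 < e x y ->
  (forall v, v \in U -> `|ka v + kp v| <= al v + be v) ->
  (forall v, v \in U -> (2 %| be v - kp v)%Z) ->
  \sum_(v in U) al v + \sum_(v in U) be v <=
     N - 2 + nrm m (\sum_(v in U) s v + \sum_(v in U) kp v) ->
  (forall A, A \subset U -> A != set0 -> A != U ->
    (A = [set v1] /\ nrm m (s v1 + (kp v1 - eps * (ind x v1 - ind y v1))) = 0) \/
    N - 2 + nrm m (\sum_(v in A) s v +
      (\sum_(v in A) kp v - eps * ((x \in A)%:Z - (y \in A)%:Z))) <=
    cut U e al A - ((x \in A)%:Z * (y \notin A)%:Z + (y \in A)%:Z * (x \notin A)%:Z)
     + \sum_(v in A) be v) ->
  orientable N U e (fun v => s v - ka v).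
Proof.
move=> below adm eps1 xy xU yU exy kaP beP DP cutP.
(* Forced by the requirement that the targets left after subtracting the arcs at z0 change only by
   the contribution of the deleted arc. *)
pose sg v := kp v - eps * (ind x v - ind y v).
apply: (@orientable_del _ N eps U e x y _ (fun v => (s v + sg v) - (ka v + kp v))) => //.
  by move=> v vU; apply/dvdzP; exists 0; rewrite /sg; ring.
apply: (below U _ (fun v => al v + be v) (fun v => ka v + kp v) _ v1).
  apply: (admissible_update adm _ _ _ kaP beP).
  - by move=> a b; rewrite edgeC.
  - by move=> a; rewrite edge_diag // oppr0.
  - move=> a b; have exy1 : 0 <= e x y - edge_ind x y x y.
      by rewrite /edge_ind /ind !eqxx (negbTE xy); lia.
    have [/andP[/eqP-> /eqP->] //|n1] := boolP ((a == x) && (b == y)).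
    have [/andP[/eqP-> /eqP->]|n2] := boolP ((a == y) && (b == x)).
      by rewrite (adm_sym adm) edgeC.
    have -> : edge_ind x y a b = 0.
      move: n1 n2; rewrite /edge_ind /ind.
      by case: (a == x); case: (b == y); case: (a == y); case: (b == x).
    by rewrite subr0 (adm_ge0 adm).
  - move=> v vU; rewrite sumrN sum_edge xU yU !mulr1 /sg.
    set z := ind x v - ind y v.
    have -> : kp v - eps * z - (- (ind x v + ind y v) + be v) =
      - (be v - kp v) - (eps * z - z) + ind y v * 2 by rewrite /z; ring.
    apply: rpredD; last exact: dvdz_mull.
    by apply: rpredB; [rewrite rpredN beP | exact: sign_parity].
  - rewrite (eq_bigr (fun v => - (eps * (ind x v - ind y v)))) => [|v _]; last by rewrite /sg; ring.
    by rewrite sumrN -mulr_sumr sumrB !sum_ind xU yU subrr mulr0 oppr0.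
  - by rewrite /sg sumrB -mulr_sumr sumrB !sum_ind xU yU subrr mulr0 subr0.
  move=> A AU A0 AnU; rewrite sumrB -mulr_sumr sumrB !sum_ind cut_edgeN // [cut _ _ _ _ + _]addrA; exact: cutP.
left; rewrite /weight ltrD2r.
under eq_bigr do rewrite big_split /= sumrN.
by rewrite sumrB sum2_edge xU yU ltrBlDr ltrDl.
Qed.

(* The edge is replaced by the oriented path from [x] to [y] through z0. *)
Lemma step_reroute U e al ka s v0 x y :
  solved_below U e al -> admissible U e al ka s v0 -> x != y -> x \in U -> y \in U ->
  0 < e x y -> \sum_(v in U) al v <= N - 4 + nrm m (\sum_(v in U) s v) ->
  orientable N U e (fun v => s v - ka v).
Proof.
move=> below adm xy xU yU exy D.
apply: (@step_edge U e al ka s v0 v0 1 x y (fun v => ind x v + ind y v)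
  (fun v => ind x v - ind y v)) => //.
- move=> v vU; have := adm_arcs adm vU; rewrite /ind.
  by case: (v == x); case: (v == y) => /=; lia.
- by move=> v vU; apply/dvdzP; exists (ind y v); ring.
- by rewrite big_split sumrB /= !sum_ind xU yU subrr addr0; big_lia.
(* A set containing one end loses the edge and gains one at z0; a set containing both ends gains
   two. *)
move=> A AU A0 AnU; rewrite sumrB big_split /= !sum_ind !mul1r !subrr !addr0.
case: (adm_cut adm AU A0 AnU) => [|h]; [by left | right].
apply: le_trans h _; case: (x \in A); case: (y \in A) => /=; big_lia.
Qed.

(** Directing the edge from [x] to [y] brings both targets nearer to 2mZ, which makes up for the
    lost edge at [x] and at [y]. For larger sets the slack 2 pays for the lost edge and for a change
    of the target by 1. *)
Lemma step_delete U e al ka s v0 x y :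
  solved_below U e al -> admissible U e al ka s v0 -> strict U e al s ->
  (forall v, v \in U -> nrm m (s v) != 0) ->
  x != y -> x \in U -> y \in U -> 0 < e x y ->
  nrm m (s x - 1) = nrm m (s x) - 1 -> nrm m (s y + 1) = nrm m (s y) - 1 ->
  orientable N U e (fun v => s v - ka v).
Proof.
move=> below adm str nz xy xU yU exy sx sy.
apply: (@step_edge U e al ka s v0 v0 1 x y (fun=> 0) (fun=> 0)) => //.
- by move=> v vU; rewrite !addr0; apply: adm_arcs adm v vU.
- by rewrite !big1_eq !addr0; apply: adm_special adm.
move=> A AU A0 AnU; right; rewrite !big1_eq sub0r addr0 mul1r.
have [A2|[z Az]] := small_set A0.
  have := str A AU A2 AnU; have := nrmD_le m_gt0 (\sum_(v in A) s v) (- ((x \in A)%:Z - (y \in A)%:Z)).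
  set p := nrm _ (_ + _); set q := nrm _ _.
  by case: (x \in A); case: (y \in A) => /=; lia.
have := adm_cut adm AU A0 AnU; case=> [[Av0 s0]|].
  have v0U : v0 \in U by rewrite (subsetP AU) // Av0 inE.
  by have := nz v0 v0U; rewrite s0.
rewrite Az big_set1 !inE; case: eqVneq => [<-|zx]; case: eqVneq => [yz|zy] /=.
- by rewrite yz eqxx in xy.
- by rewrite subr0 sx; big_lia.
- by rewrite sub0r opprK -yz sy; big_lia.
- by rewrite subrr oppr0 addr0; big_lia.
Qed.

Lemma cut_nonexempt U e al ka s v0 A : admissible U e al ka s v0 ->
  (forall v, v \in U -> nrm m (s v) != 0) -> A \subset U -> A != set0 -> A != U ->
  N - 2 + nrm m (\sum_(v in A) s v) <= cut U e al A.
Proof.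
move=> adm nz AU A0 AnU; case: (adm_cut adm AU A0 AnU) => [[Av0 s0]|//].
have v0U : v0 \in U by rewrite (subsetP AU) // Av0 inE.
by have := nz v0 v0U; rewrite s0.
Qed.

(* For [eps] = 1: the m - 1 new edges leave [y] for z0, and together with the deletion of an edge
   oriented from [x] to [y] they replace the target of [y] by its antipode modulo 2m. *)
Lemma step_concentrate U e al ka s v0 (eps : int) x y :
  solved_below U e al -> admissible U e al ka s v0 -> strict U e al s ->
  (forall v, v \in U -> nrm m (s v) != 0) ->
  `|eps| = 1 -> x != y -> x \in U -> y \in U -> 0 < e x y ->
  nrm m (s x - eps) = nrm m (s x) - 1 ->
  \sum_(v in U) al v = N - 1 -> (N %| \sum_(v in U) s v + eps * (N - 1))%Z ->
  orientable N U e (fun v => s v - ka v).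
Proof.
move=> below adm str nz eps1 xy xU yU exy sx D sD.
apply: (@step_edge U e al ka s v0 v0 eps x y (fun v => ind y v * (m%:Z - 1))
  (fun v => eps * (ind y v * (m%:Z - 1)))) => //.
- move=> v vU; apply: le_trans (ler_normD _ _) _; rewrite normrM eps1 mul1r.
  by apply: lerD; [exact: adm_arcs adm v vU | rewrite ger0_norm // /ind; case: (v == y); lia].
- move=> v vU; have := sign_parity (ind y v * (m%:Z - 1)) eps1.
  by rewrite -opprB rpredN.
(* The sum of the targets becomes congruent to [- eps * m], at the maximal distance m from 2mZ, so
   z0 may have the degree (N - 1) + (m - 1) = N - 2 + m. *)
- rewrite -mulr_sumr -mulr_suml sum_ind yU mul1r D.
  rewrite (@nrm_congr m m_gt0 _ (0 + (- eps) * m%:Z)) => [|].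
    rewrite nrm_half ?normrN // (eqP (_ : nrm m 0 == 0)) ?nrm_eq0 ?dvdz0 //; lia.
  have -> : \sum_(v in U) s v + eps * (m%:Z - 1) - (0 + - eps * m%:Z) =
    (\sum_(v in U) s v + eps * (N - 1)) by rewrite PoszM; ring.
  exact: sD.
move=> A AU A0 AnU; right; rewrite -mulr_sumr -mulr_suml sum_ind.
have C1 := cut_nonexempt adm nz AU A0 AnU.
set S := \sum_(v in A) s v in C1 *.
case: (boolP (x \in A)) => xA; case: (boolP (y \in A)) => yA /=.
- rewrite mul1r subrr mulr0 subr0.
  have := nrmD_le m_gt0 S (eps * (m%:Z - 1)); rewrite normrM eps1 mul1r.
  move: (nrm m S) (nrm m (_ + _)) C1 => p q C1; lia.
- rewrite !mul0r mulr0 sub0r subr0 mulr1.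
  have [A2|[z Az]] := small_set A0.
    have := str A AU A2 AnU; have := nrmD_le m_gt0 S (- eps); rewrite normrN eps1 -/S.
    move: (nrm m S) (nrm m (_ + _)) => p q; lia.
  move: xA C1; rewrite /S Az inE big_set1 => /eqP <-; rewrite sx; lia.
(* The target of [A] passes to its antipode. For [A = [set y]] the cut grows by m - 2, while the
   bound grows by m - 2 ||s(y)||, which is no more because s(y) is nonzero. *)
- rewrite mul1r sub0r mulrN1 opprK -{2}[eps]mulr1 -mulrDr subrK nrm_half //.
  have [A2|[z Az]] := small_set A0.
    have := str A AU A2 AnU; have := nrm_ge0 m_gt0 S; rewrite -/S.
    move: (nrm m S) => p; lia.
  move: yA C1; rewrite /S Az inE big_set1 => /eqP <-.
  have := nz y yU; have := nrm_ge0 m_gt0 (s y).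
  move: (nrm m (s y)) => p; lia.
rewrite [X in S + X](_ : _ = 0) ?addr0; last by ring.
by move: C1; move: (nrm m S) => p; lia.
Qed.

Lemma orientable_eq_mul U e e' (r : V -> int) :
  (forall x y, e' x y = e x y) -> orientable N U e' r -> orientable N U e r.
Proof.
by move=> E [g [gA gB gP gS]]; exists g; split=> // x y xU yU; rewrite -E; [exact: gB | exact: gP].
Qed.

Lemma cut_no_edge U be A : cut U (fun _ _ => 0) be A = \sum_(v in A) be v.
Proof. by apply: eq_bigr => x _; rewrite big1_eq add0r. Qed.

(** By parity, the condition on [ka x] says that some edge between [x] and z0 leaves [x] ([eps = 1])
    or enters it ([eps = -1]). This edge is deleted: the weight stays and the degree of z0 falls. *)
Lemma step_arc U e al ka s v0 (eps : int) x :
  solved_below U e al -> admissible U e al ka s v0 -> strict U e al s ->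
  (forall v, v \in U -> nrm m (s v) != 0) ->
  `|eps| = 1 -> x \in U -> `|ka x - eps| <= al x - 1 ->
  nrm m (s x - eps) = nrm m (s x) - 1 ->
  orientable N U e (fun v => s v - ka v).
Proof.
move=> below adm str nz eps1 xU kax sx.
apply: (@orientable_eq_mul U e (fun x y => e x y + 0)) => [a b|]; first by rewrite addr0.
apply: (@orientable_congr _ N U _ _
  (fun v => (s v + - (eps * ind x v)) - (ka v + - (eps * ind x v)))) => [v vU|].
  by apply/dvdzP; exists 0; ring.
apply: (below U _ (fun v => al v + - ind x v) (fun v => ka v + - (eps * ind x v)) _ v0).
  apply: (admissible_update adm) => //.
  - by move=> a b; rewrite addr0 (adm_ge0 adm).
  - move=> v vU; rewrite /ind; case: eqP => [->|_]; first by rewrite mulr1.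
    by rewrite mulr0 !oppr0 !addr0; apply: adm_arcs adm v vU.
  - move=> v vU; rewrite opprK addrC; exact: sign_parity.
  - move=> v vU; rewrite big1_eq add0r -opprD rpredN.
    exact: sign_parity.
  - by rewrite big1 ?dvdz0 // => v _; rewrite subrr.
  - rewrite !sumrN -mulr_sumr !sum_ind xU mulr1.
    have := adm_special adm; have := nrmD_le m_gt0 (\sum_(v in U) s v - eps) eps.
    rewrite subrK eps1; move: (\sum_(v in U) al v) (nrm m _) (nrm m _) => p q r; lia.
  move=> A AU A0 AnU; right; rewrite cut_no_edge.
  rewrite !sumrN -mulr_sumr !sum_ind.
  have C1 := cut_nonexempt adm nz AU A0 AnU.
  case: (boolP (x \in A)) => xA; last by rewrite mulr0 !subr0.
  rewrite mulr1; have [A2|[z Az]] := small_set A0.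
    have := str A AU A2 AnU; have := nrmD_le m_gt0 (\sum_(v in A) s v) (- eps).
    rewrite normrN eps1; move: (nrm m _) (nrm m _) => p q; lia.
  move: xA C1; rewrite Az inE !big_set1 => /eqP <-; rewrite sx; lia.
right; split; last by rewrite big_split /= sumrN sum_ind xU; rewrite gtrDl oppr_lt0.
rewrite /weight; congr (_ + _); apply: eq_bigr => a _; apply: eq_bigr => b _; exact: addr0.
Qed.

(* The lifted pair consists of the edge between [u] and [v0] and an edge between [v0] and z0. *)
Lemma step_lift_arc U e al ka s v0 (eps : int) u :
  solved_below U e al -> admissible U e al ka s v0 -> strict U e al s ->
  nrm m (s v0) = 0 -> `|eps| = 1 -> u != v0 -> u \in U -> v0 \in U -> 0 < e u v0 ->
  `|ka v0 - eps| <= al v0 - 1 ->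
  orientable N U e (fun v => s v - ka v).
Proof.
move=> below adm str s0 eps1 uv uU vU euv kav.
apply: (@step_edge U e al ka s v0 v0 eps u v0 (fun v => ind u v - ind v0 v)
  (fun v => eps * (ind u v - ind v0 v))) => //.
- move=> v wU; have := adm_arcs adm wU; rewrite /ind.
  case: eqP => [->|_]; case: eqP => [vE|_] /=.
  + by rewrite vE eqxx in uv.
  + rewrite subr0 mulr1 => h; apply: le_trans (ler_normD _ _) _; rewrite eps1; lia.
  + by rewrite vE sub0r mulrN1.
  + by rewrite subrr mulr0 !addr0.
- by move=> v _; rewrite -opprB rpredN; apply: sign_parity.
- rewrite -mulr_sumr sumrB !sum_ind uU vU subrr mulr0 !addr0; exact: adm_special adm.
move=> A AU A0 AnU; rewrite -mulr_sumr sumrB !sum_ind !subrr !addr0 s0.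
have [AE|AnE] := eqVneq A [set v0]; [by left | right].
have C1 : N - 2 + nrm m (\sum_(v in A) s v) <= cut U e al A.
  by case: (adm_cut adm AU A0 AnU) => // -[AE]; rewrite AE eqxx in AnE.
case: (boolP (u \in A)) => uA; case: (boolP (v0 \in A)) => vA /=.
- by move: C1; clear; move: (nrm m _) => p; lia.
- by move: C1; clear; move: (nrm m _) => p; lia.
(* The lifted pair costs this cut 2 edges; [A] has a vertex besides [v0], hence slack 2. *)
- have [A2|[z Az]] := small_set A0.
    by have := str A AU A2 AnU; clear; move: (nrm m _) => p; lia.
  by move: vA AnE; rewrite Az inE => /eqP->; rewrite eqxx.
- by move: C1; clear; move: (nrm m _) => p; lia.
Qed.

(** A cut changes only if it separates [v0] from both [u] and [w], and then it loses 2. Such a set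
    is [[set v0]], which is exempt, or has at least two vertices and hence slack 2. *)
Lemma step_lift U e al ka s v0 u w :
  solved_below U e al -> admissible U e al ka s v0 -> strict U e al s ->
  nrm m (s v0) = 0 -> u != v0 -> v0 != w -> u != w -> u \in U -> v0 \in U -> w \in U ->
  0 < e u v0 -> 0 < e v0 w -> orientable N U e (fun v => s v - ka v).
Proof.
move=> below adm str s0 uv vw uw uU vU wU euv evw.
have eC := adm_sym adm.
apply: (@orientable_lift _ N U e u v0 w) => //; first exact: adm_ge0 adm u w.
apply: (@orientable_congr _ N U _ _ (fun v => (s v + 0) - (ka v + 0))) => [v _|].
  by apply/dvdzP; exists 0; ring.
pose f a b := edge_ind u w a b - edge_ind u v0 a b - edge_ind v0 w a b.
have cutf A : A \subset U -> cut U f (fun=> 0) A =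
    ((u \in A)%:Z * (w \notin A)%:Z + (w \in A)%:Z * (u \notin A)%:Z) -
    ((u \in A)%:Z * (v0 \notin A)%:Z + (v0 \in A)%:Z * (u \notin A)%:Z) -
    ((v0 \in A)%:Z * (w \notin A)%:Z + (w \in A)%:Z * (v0 \notin A)%:Z).
  move=> AU; rewrite /cut /f; under eq_bigr do rewrite addr0 !sumrB.
  by rewrite !sumrB !sum2_edge !inE uU vU wU !andbT.
apply: (below U _ (fun v => al v + 0) (fun v => ka v + 0) _ v0).
  apply: (admissible_update adm).
  - by move=> a b; rewrite (edgeC u w) (edgeC u v0) (edgeC v0 w).
  - by move=> a; rewrite !edge_diag.
  - move=> a b; have e1 : edge_ind u v0 u v0 = 1 /\ edge_ind u v0 v0 u = 1.
      by rewrite /edge_ind /ind !eqxx [v0 == u]eq_sym (negbTE uv).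
    have e2 : edge_ind v0 w v0 w = 1 /\ edge_ind v0 w w v0 = 1.
      by rewrite /edge_ind /ind !eqxx [w == v0]eq_sym (negbTE vw).
    have z1 : edge_ind v0 w u v0 = 0 /\ edge_ind v0 w v0 u = 0.
      by rewrite /edge_ind /ind !eqxx (negbTE uv) (negbTE vw) (negbTE uw).
    have z2 : edge_ind u v0 v0 w = 0 /\ edge_ind u v0 w v0 = 0.
      by rewrite /edge_ind /ind !eqxx ![w == _]eq_sym (negbTE vw) (negbTE uw) [v0 == u]eq_sym (negbTE uv).
    have h a1 b1 : 0 <= edge_ind u w a1 b1 by rewrite /edge_ind /ind addr_ge0 ?mulr_ge0.
    have lift_ge0 (p q : int) : 0 < p -> 0 <= q -> 0 <= p + (q - 1 - 0) by clear; lia.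
    have lift_ge0' (p q : int) : 0 < p -> 0 <= q -> 0 <= p + (q - 0 - 1) by clear; lia.
    have [/andP[/eqP-> /eqP->]|n1] := boolP ((a == u) && (b == v0)).
      by case: e1 z1 => -> _ [-> _]; apply: lift_ge0.
    have [/andP[/eqP-> /eqP->]|n2] := boolP ((a == v0) && (b == u)).
      by rewrite eC; case: e1 z1 => _ -> [_ ->]; apply: lift_ge0.
    have [/andP[/eqP-> /eqP->]|n3] := boolP ((a == v0) && (b == w)).
      by case: e2 z2 => -> _ [-> _]; apply: lift_ge0'.
    have [/andP[/eqP-> /eqP->]|n4] := boolP ((a == w) && (b == v0)).
      by rewrite eC; case: e2 z2 => _ -> [_ ->]; apply: lift_ge0'.
    have -> : edge_ind u v0 a b = 0.
      by move: n1 n2; rewrite /edge_ind /ind; case: (a == u); case: (b == v0); case: (a == v0); case: (b == u).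
    have -> : edge_ind v0 w a b = 0.
      by move: n3 n4; rewrite /edge_ind /ind; case: (a == v0); case: (b == w); case: (a == w); case: (b == v0).
    by rewrite !subr0 addr_ge0 ?(adm_ge0 adm) ?h.
  - by move=> v aU; rewrite !addr0; apply: adm_arcs adm v aU.
  - by move=> v aU; rewrite subrr dvdz0.
  - move=> v aU; rewrite !sumrB !sum_edge uU vU wU !mulr1 sub0r rpredN addr0.
    by apply/dvdzP; exists (- ind v0 v); ring.
  - by rewrite big1 ?dvdz0 // => v _; rewrite subrr.
  - by rewrite !big1_eq !addr0; apply: adm_special adm.
  move=> A AU A0 AnU; rewrite cutf // big1_eq !addr0 s0.
  have [AE|AnE] := eqVneq A [set v0]; [by left | right].
  have C1 : N - 2 + nrm m (\sum_(v in A) s v) <= cut U e al A.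
    by case: (adm_cut adm AU A0 AnU) => // -[AE]; rewrite AE eqxx in AnE.
  have [A2|[z Az]] := small_set A0.
    rewrite -addrA; apply: le_trans (_ : _ <= cut U e al A - 2) _.
      by have := str A AU A2 AnU; clear; move: (nrm m _) => p; lia.
    by rewrite lerD2l; case: (u \in A); case: (v0 \in A); case: (w \in A).
  have vA : v0 \notin A.
    by apply: contra AnE; rewrite Az inE => /eqP->.
  have uwA : (u \in A) && (w \in A) = false.
    by rewrite Az !inE; apply/negbTE/negP => /andP[/eqP<- /eqP wu]; rewrite wu eqxx in uw.
  apply: le_trans C1 _; rewrite (negbTE vA) lerDl.
  by move: uwA; case: (u \in A); case: (w \in A).
left; rewrite /weight ltrD2r.
under eq_bigr do rewrite big_split /= !sumrB.
by rewrite big_split /= gtrDl !sumrB !sum2_edge uU vU wU.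
Qed.

(** * Restriction to a subset and removal of a vertex of target 0 *)

Lemma sum_setD F A U : A \subset U ->
  \sum_(x in U) F x = \sum_(x in A) F x + \sum_(x in U :\: A) F x.
Proof. by move=> AU; rewrite (big_setID A) /= (setIidPr AU). Qed.

Lemma ler_sum_subset F A U : A \subset U -> (forall x, 0 <= F x) ->
  \sum_(x in A) F x <= \sum_(x in U) F x.
Proof. by move=> AU F0; rewrite (sum_setD _ AU) lerDl sumr_ge0. Qed.

Lemma weight_subset U A e : (forall x y, 0 <= e x y) -> A \subset U -> A != U ->
  weight A e < weight U e.
Proof.
move=> e0 AU AnU; rewrite /weight; apply: ler_ltD; last first.
  by rewrite ltz_nat proper_card // properEneq AnU.
apply: le_trans (ler_sum_subset AU _); last by move=> x; apply: sumr_ge0.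
by apply: ler_sum => x _; apply: ler_sum_subset.
Qed.

(** By parity the number of edges from [v0] to its only possible neighbour [u] is even, so they can
    be directed half each way. The choice [u = v0] covers a vertex without edges. *)
Lemma step_remove U e al ka s v0 u :
  solved_below U e al -> admissible U e al ka s v0 -> v0 \in U -> nrm m (s v0) = 0 ->
  al v0 = 0 -> (forall y, y \in U -> y != u -> e v0 y = 0) ->
  orientable N U e (fun v => s v - ka v).
Proof.
move=> below adm vU /eqP s0 al0 eu; rewrite nrm_eq0 // in s0.
have eC := adm_sym adm; have e0 := adm_diag adm.
have ka0 : ka v0 = 0 by have := adm_arcs adm vU; rewrite al0; lia.
have s2 : (2 %| s v0)%Z by apply: dvdz_trans s0; rewrite PoszM dvdz_mulr.
have ev2 y : y \in U -> (2 %| e v0 y)%Z.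
  move=> yU; have [yu|yu] := eqVneq y u; last by rewrite eu.
  have := adm_parity adm vU; rewrite al0 addr0 (big_setD1 y yU) /= big1 ?addr0 => [|z].
    by move=> h; have := rpredB s2 h; rewrite opprB addrC subrK.
  by rewrite !inE => /andP[zy zU]; apply: eu; rewrite // -yu.
have UE F : \sum_(x in U) F x = F v0 + \sum_(x in U :\ v0) F x by rewrite (big_setD1 v0).
apply: (@orientable_remove _ N U e _ v0 vU eC _ ev2); first by move=> y _; apply: adm_ge0 adm _ _.
  by rewrite ka0 subr0.
have UvU : U :\ v0 \subset U by rewrite subD1set.
have inU v : v \in U :\ v0 -> v \in U by move/(subsetP UvU).
apply: (below _ _ al ka s v0); last first.
  left; apply: weight_subset => //; first exact: adm_ge0 adm.
  by apply/eqP => E; have := vU; rewrite -E !inE eqxx.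
split=> //; try by [exact: adm_ge0 adm].
- by move=> v /inU; apply: adm_arcs adm v.
- by move=> v /inU; apply: adm_arcs_parity adm v.
- move=> v /inU wU; have := adm_parity adm wU; rewrite UE => h.
  have -> : s v - (\sum_(y in U :\ v0) e v y + al v) =
    (s v - (e v v0 + \sum_(y in U :\ v0) e v y + al v)) + e v v0 by ring.
  by apply: rpredD h _; rewrite eC ev2.
- have := adm_sum adm; rewrite UE ka0 subr0 => h.
  by have := rpredB h s0; rewrite addrC addKr.
- have := adm_special adm; rewrite !UE al0 add0r.
  by rewrite (@nrm_congr m m_gt0 _ (\sum_(v in U :\ v0) s v)) // addrK.
move=> A AU A0 AnU; right.
have AU' : A \subset U := subset_trans AU UvU.
have vA : v0 \notin A by apply/negP => /(subsetP AU); rewrite !inE eqxx.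
(* In the comparison [v0] is put on the side of [u], so that no edge at [v0] is cut. *)
case: (boolP (u \in A)) => uA.
  have -> : cut (U :\ v0) e al A = cut U e al (v0 |: A).
    rewrite /cut big_setU1 //= al0 addr0 [X in _ = X + _]big1 ?add0r => [|y]; last first.
      rewrite !inE negb_or => /andP[/andP[_ yA] yU]; apply: eu => //.
      by apply: contraNneq yA => ->.
    apply: eq_bigr => x _; congr (_ + _); apply: eq_bigl => y; rewrite !inE negb_or.
    by case: (y == v0); case: (y \in A).
  have B1 : v0 |: A \subset U by rewrite subUset sub1set vU.
  have B2 : v0 |: A != set0 by apply/set0Pn; exists v0; rewrite !inE eqxx.
  have B3 : v0 |: A != U.
    apply: contraNneq AnU => E; rewrite -E; apply/eqP/setP => y; rewrite !inE.
    by case: eqVneq => [->|]; rewrite ?(negbTE vA).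
  case: (adm_cut adm B1 B2 B3) => [[E _]|].
    have [z zA] := set0Pn _ A0; have : z \in v0 |: A by rewrite !inE zA orbT.
    by rewrite E inE => /eqP zv; rewrite -zv zA in vA.
  rewrite big_setU1 //= (@nrm_congr m m_gt0 (s v0 + _) (\sum_(v in A) s v)) // addrK //.
have -> : cut (U :\ v0) e al A = cut U e al A.
  rewrite /cut; apply: eq_bigr => x xA; congr (_ + _).
  rewrite [RHS](big_setD1 v0) /=; last by rewrite !inE vA vU.
  rewrite eC eu ?add0r ?(subsetP AU') //; last by apply: contraNneq uA => <-.
  by apply: eq_bigl => y; rewrite !inE; case: (y == v0); case: (y \in A).
have AnU' : A != U by apply: contraNneq vA => ->.
by case: (adm_cut adm AU' A0 AnU') => // -[AE _]; rewrite AE inE eqxx in vA.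
Qed.

(** * Contraction of a tight set; [expand A a B] is the preimage of [B] *)

Definition expand A a B := if a \in B then A :|: (B :\ a) else B.

Lemma sum_contract U A a B F : a \in A -> B \subset a |: U :\: A ->
  \sum_(x in B) contract_fun A a F x = \sum_(x in expand A a B) F x.
Proof.
move=> aA BU; have nBA x : x \in B -> x != a -> x \notin A.
  move=> xB xa; have := subsetP BU x xB; rewrite !inE (negbTE xa) /=.
  by case/andP.
rewrite /expand; case: ifP => aB.
  rewrite (big_setD1 a aB) /= {1}/contract_fun eqxx.
  rewrite [RHS](sum_setD _ (subsetUl A (B :\ a))); congr (_ + _).
  rewrite setDUl setDv set0U; apply: eq_big => x.
    by rewrite !inE; case: (boolP (x \in B)) => xB; case: (eqVneq x a) => xa; rewrite ?andbF //= nBA.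
  by rewrite !inE => /andP[/negbTE xa _]; rewrite /contract_fun xa.
apply: eq_bigr => x xB; rewrite /contract_fun; case: eqP => // xa.
by rewrite xa aB in xB.
Qed.

Lemma expand_full U A a : A \subset U -> a \in A -> expand A a (a |: U :\: A) = U.
Proof.
move=> AU aA; rewrite /expand !inE eqxx /=; apply/setP => x; rewrite !inE.
case: (boolP (x \in A)) => xA /=; first by rewrite (subsetP AU).
by have [xa|//] := eqVneq x a; rewrite xa aA in xA.
Qed.

Lemma cut_contract U A a B e al : A \subset U -> a \in A -> B \subset a |: U :\: A ->
  cut (a |: U :\: A) (contract_mul A a e) (contract_fun A a al) B = cut U e al (expand A a B).
Proof.
move=> AU aA BU; rewrite /cut !big_split /= (sum_contract _ aA BU); congr (_ + _).
set U1 := a |: U :\: A in BU *.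
have U1D : U1 :\: B \subset U1 by rewrite subsetDl.
have inU1 x : x \in U1 -> (x == a) || (x \in U) && (x \notin A) by rewrite !inE andbC.
case: (boolP (a \in B)) => aB.
  rewrite exchange_big /= [RHS]exchange_big /=.
  have -> : U :\: expand A a B = U1 :\: B.
    apply/setP => x; rewrite /expand aB !inE.
    have [->|xa] := eqVneq x a; first by rewrite aA aB.
    by rewrite /= negb_or; case: (x \in A); case: (x \in B).
  apply: eq_bigr => y; rewrite !inE => /andP[yB _].
  have ya : y != a by apply: contraNneq yB => ->.
  rewrite -(sum_contract _ aA BU); apply: eq_bigr => x _.
  by rewrite /contract_mul /contract_fun (negbTE ya).
have -> : expand A a B = B by rewrite /expand (negbTE aB).
apply: eq_bigr => x xB; have xa : x != a by apply: contraNneq aB => <-.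
have -> : U :\: B = expand A a (U1 :\: B).
  rewrite /expand !inE eqxx aB /=; apply/setP => y; rewrite !inE.
  have nBA : y \in B -> y \notin A.
    move=> yB; have := subsetP BU y yB; rewrite !inE => /predU1P[ya|/andP[]//].
    by rewrite -ya yB in aB.
  have [ya|ya] := eqVneq y a; first by rewrite ya aA aB (subsetP AU).
  case: (boolP (y \in A)) => yA /=; last by rewrite andbC.
  by rewrite (subsetP AU) // andbT; apply: contraTN yA.
rewrite -(sum_contract _ aA U1D); apply: eq_bigr => y _.
by rewrite /contract_mul /contract_fun (negbTE xa).
Qed.

(** The cuts of the contracted graph are the cuts of preimages. The preimage of a set containing [a]
    has at least two vertices, so it is never the exempt one. *)
Lemma contract_admissible U A a e al ka s v0 : admissible U e al ka s v0 ->
  A \subset U -> a \in A -> (1 < #|A|)%N ->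
  admissible (a |: U :\: A) (contract_mul A a e) (contract_fun A a al)
    (contract_fun A a ka) (contract_fun A a s) v0.
Proof.
move=> adm AU aA A1; have eC := adm_sym adm; have e0 := adm_diag adm.
have inU x : x \in a |: U :\: A -> x \in U.
  by rewrite !inE => /predU1P[->|/andP[]//]; apply: (subsetP AU).
have full F : \sum_(x in a |: U :\: A) contract_fun A a F x = \sum_(x in U) F x.
  by rewrite (sum_contract _ aA (subxx _)) expand_full.
split.
- move=> x y; rewrite /contract_mul.
  by case: eqVneq => xa; case: eqVneq => ya //; try (apply: eq_bigr => b _; exact: eC); exact: eC.
- by move=> x; rewrite /contract_mul; case: eqVneq.
- move=> x y; rewrite /contract_mul.
  by case: eqVneq => xa; case: eqVneq => ya //; try (apply: sumr_ge0 => b _); exact: adm_ge0 adm _ _.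
- move=> x /inU xU; rewrite /contract_fun; case: eqP => [_|_]; last exact: adm_arcs adm x xU.
  apply: le_trans (ler_norm_sum _ _ _) _; apply: ler_sum => b bA.
  by apply: (adm_arcs adm); apply: (subsetP AU).
- move=> x /inU xU; rewrite /contract_fun; case: eqP => [_|_]; last exact: adm_arcs_parity adm x xU.
  rewrite -sumrB; apply: dvdz_sum => b bA.
  by apply: (adm_arcs_parity adm); apply: (subsetP AU).
- move=> x xU1; have xU := inU x xU1; have [xa|xa] := eqVneq x a.
    have := cut_parity (adm_sym adm) (adm_diag adm) (adm_parity adm) AU; rewrite xa /contract_fun eqxx.
    have -> : \sum_(y in a |: U :\: A) contract_mul A a e a y + \sum_(b in A) al b = cut U e al A.
      rewrite /cut big_split /=; congr (_ + _); rewrite big_setU1 ?inE ?aA //=.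
      rewrite {1}/contract_mul !eqxx add0r [RHS]exchange_big /=; apply: eq_bigr => y.
      rewrite !inE => /andP[yA _]; rewrite /contract_mul eqxx.
      by case: eqP => // ya; rewrite ya aA in yA.
    by rewrite -opprB rpredN.
  have -> : \sum_(y in a |: U :\: A) contract_mul A a e x y = \sum_(y in U) e x y.
    rewrite -full; apply: eq_bigr => y _.
    by rewrite /contract_mul /contract_fun (negbTE xa).
  by rewrite /contract_fun (negbTE xa); apply: adm_parity adm x xU.
- have := adm_sum adm; rewrite -full.
  rewrite [X in (_ %| X)%Z -> _](eq_bigr (fun v => contract_fun A a s v - contract_fun A a ka v)) //.
  by move=> v _; rewrite /contract_fun; case: eqP => // _; rewrite sumrB.
- by rewrite !full; apply: adm_special adm.
move=> B BU B0 BnU; rewrite cut_contract // (sum_contract _ aA BU).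
have EU : expand A a B \subset U.
  rewrite /expand; case: ifP => _; last by apply/subsetP => x /(subsetP BU) /inU.
  rewrite subUset AU; apply/subsetP => x; rewrite !inE => /andP[_ /(subsetP BU)]; exact: inU.
have E0 : expand A a B != set0.
  by rewrite /expand; case: ifP => // _; apply/set0Pn; exists a; rewrite inE aA.
have EnU : expand A a B != U.
  apply: contraNneq BnU => E; rewrite eqEsubset BU; apply/subsetP => x xU1.
  move: (inU x xU1); rewrite -E /expand; case: ifP => [aB|//].
  move: xU1; rewrite !inE => /predU1P[->//|/andP[/negbTE-> _]] /=.
  by case/andP.
case: (adm_cut adm EU E0 EnU) => [[Ev s0]|]; last by right.
move: Ev s0; rewrite /expand; case: ifP => aB => [Ev|Bv].
  have : (#|A| <= #|[set v0]|)%N by rewrite -Ev subset_leq_card // subsetUl.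
  by rewrite cards1 leqNgt A1.
move=> s0; left; split=> //; rewrite /contract_fun; case: eqP => // va.
by rewrite Bv va inE eqxx in aB.
Qed.

Lemma weight_contract U A a e : A \subset U -> a \in A -> (1 < #|A|)%N ->
  (forall x y, 0 <= e x y) ->
  weight (a |: U :\: A) (contract_mul A a e) < weight U e.
Proof.
move=> AU aA A1 e0; have aN : a \notin U :\: A by rewrite !inE aA.
rewrite /weight; apply: ler_ltD; last first.
  rewrite ltz_nat cardsU1 aN cardsD (setIidPr AU).
  by have := subset_leq_card AU; lia.
rewrite big_setU1 //= [leRHS](sum_setD _ AU); apply: lerD.
  rewrite big_setU1 //= {1}/contract_mul !eqxx add0r.
  rewrite (eq_bigr (fun y => \sum_(b in A) e b y)) => [|y]; last first.
    rewrite !inE => /andP[yA _]; rewrite /contract_mul eqxx.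
    by case: eqP => // ya; rewrite ya aA in yA.
  rewrite exchange_big /=; apply: ler_sum => b _.
  by apply: ler_sum_subset => //; rewrite subsetDl.
apply: ler_sum => x; rewrite !inE => /andP[xA _].
have xa : x != a by apply: contraNneq xA => ->.
rewrite -[in leRHS](expand_full AU aA) -(sum_contract _ aA (subxx _)).
by apply: ler_sum => y _; rewrite /contract_mul /contract_fun (negbTE xa).
Qed.

(** Tightness is used for the inside: there the outside of [A] acts as special vertex, its degree is
    the cut of [A], and tightness is the bound required of this degree. *)
Lemma step_contract U A e al ka s v0 :
  solved_below U e al -> admissible U e al ka s v0 ->
  A \subset U -> (1 < #|A|)%N -> A != U ->
  cut U e al A <= N - 2 + nrm m (\sum_(v in A) s v) ->
  orientable N U e (fun v => s v - ka v).
Proof.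
move=> below adm AU A1 AnU tight.
have [a aA] : exists a, a \in A by apply/set0Pn; rewrite -card_gt0; lia.
have eC := adm_sym adm; have e0 := adm_ge0 adm.
apply: (orientable_contract AU aA eC e0).
  apply: orientable_congr (below _ _ _ _ _ _ (contract_admissible adm AU aA A1) _).
    move=> v _; rewrite (_ : _ - _ = 0) // /contract_fun; case: eqP => _; last by rewrite subrr.
    by rewrite sumrB subrr.
  by left; apply: weight_contract.
move=> h h1 h2 h3.
apply: (@orientable_congr _ N A e _
  (fun v => s v - (ka v + \sum_(x in U :\: A) h v x))) => [v vA|].
  by apply/dvdzP; exists 0; ring.
apply: (below A e (fun v => al v + \sum_(x in U :\: A) e v x) _ s v0); last first.
  by left; apply: weight_subset.
have outer B : B \subset A -> cut A e (fun v => al v + \sum_(x in U :\: A) e v x) B = cut U e al B.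
  move=> BA; apply: eq_bigr => x xB; rewrite [al x + _]addrC addrA; congr (_ + _).
  have sub : U :\: A \subset U :\: B by rewrite setDS.
  rewrite (sum_setD _ sub) addrC; congr (_ + _); apply: eq_bigl => y; rewrite !inE.
  by have := subsetP AU y; case: (y \in A); case: (y \in B); case: (y \in U) => // ->.
have inU x : x \in A -> x \in U by move/(subsetP AU).
split=> //.
- exact: adm_diag adm.
- move=> v vA; apply: le_trans (ler_normD _ _) _; apply: lerD; first exact: adm_arcs adm v (inU v vA).
  apply: le_trans (ler_norm_sum _ _ _) _; apply: ler_sum => x xo; exact: h1.
- move=> v vA; have -> : al v + \sum_(x in U :\: A) e v x - (ka v + \sum_(x in U :\: A) h v x) =
    (al v - ka v) - \sum_(x in U :\: A) (h v x - e v x) by rewrite sumrB; ring.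
  apply: rpredB; first exact: adm_arcs_parity adm v (inU v vA).
  by apply: dvdz_sum => x xo; apply: h2.
- move=> v vA; have := adm_parity adm (inU v vA); rewrite (sum_setD _ AU).
  by congr (_ %| _)%Z; ring.
- by move: h3; congr (_ %| _)%Z; apply: eq_bigr => v _; ring.
- have := outer A (subxx A); rewrite /cut setDv.
  under eq_bigr do rewrite big_set0 add0r.
  by move=> ->.
move=> B BA B0 BnA; rewrite outer //.
apply: (adm_cut adm) => //; first exact: subset_trans BA AU.
by apply: contraNneq AnU => E; rewrite eqEsubset AU -E.
Qed.

(** * Case analysis and induction *)

Lemma step_small U e al ka s v0 : admissible U e al ka s v0 -> (#|U| <= 1)%N ->
  orientable N U e (fun v => s v - ka v).
Proof.
move=> adm; rewrite leq_eqVlt ltnS leqn0 => /orP[/cards1P[z UE]|]; last first.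
  by rewrite cards_eq0 => /eqP ->; exists (fun _ _ => 0); split=> // x; rewrite ?oppr0 // inE.
exists (fun _ _ => 0); split=> [x y|x y xU yU|x y|v].
- by rewrite oppr0.
- by rewrite normr0 (adm_ge0 adm).
- by rewrite UE !inE => /eqP-> /eqP->; rewrite (adm_diag adm) subrr.
rewrite big1_eq sub0r rpredN UE inE => /eqP->.
by have := adm_sum adm; rewrite UE big_set1.
Qed.

Lemma sum_setC1_cut U e al ka s v0 v : admissible U e al ka s v0 -> v \in U ->
  (forall y, y \in U -> y != v -> e v y = 0) ->
  cut U e al (U :\ v) = \sum_(x in U) al x - al v.
Proof.
move=> adm vU ev; rewrite /cut big_split /= [X in X + _]big1 ?add0r => [|x].
  by rewrite [in RHS](big_setD1 v) //= addrAC subrr add0r.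
rewrite !inE => /andP[xv xU]; rewrite big1 // => y; rewrite !inE => /andP[].
rewrite negb_and negbK => /orP[/eqP-> _|/negbTE-> //].
by rewrite (adm_sym adm) ev.
Qed.

Lemma proper_setD1 U v : (1 < #|U|)%N -> v \in U ->
  [/\ U :\ v \subset U, U :\ v != set0, U :\ v != U & v \notin U :\ v].
Proof.
move=> U1 vU; split; first exact: subD1set.
- by rewrite -card_gt0; move: U1; rewrite (cardsD1 v) vU.
- by apply/eqP => E; have := vU; rewrite -E !inE eqxx.
by rewrite !inE eqxx.
Qed.

(** With two neighbours of [v0] in [U], a pair of edges is lifted. With one, an edge to it is lifted
    together with an edge to z0; if z0 is not adjacent, [v0] is removed. *)
Lemma step_exempt U e al ka s v0 : (1 < #|U|)%N ->
  solved_below U e al -> admissible U e al ka s v0 -> strict U e al s ->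
  v0 \in U -> nrm m (s v0) = 0 ->
  orientable N U e (fun v => s v - ka v).
Proof.
move=> U1 below adm str vU s0; have eC := adm_sym adm; have e0 := adm_ge0 adm.
have kal := adm_arcs adm vU.
have zero y : ~~ (0 < e v0 y) -> e v0 y = 0 by rewrite -leNgt => h; apply/eqP; rewrite eq_le h e0.
have [/exists_inP[u uU /andP[uv euv]]|none] :=
    boolP [exists u in U, (u != v0) && (0 < e v0 u)]; last first.
  have ev y : y \in U -> y != v0 -> e v0 y = 0.
    move=> yU yv; apply: zero; move: none; rewrite negb_exists_in.
    by move=> /forall_inP /(_ y yU); rewrite yv.
  (* The other vertices have a cut of [D - al v0] edges, where D is the degree of z0. As [v0] has
     target 0, the lower bound for this cut is also the upper bound for D. *)
  have al0 : al v0 = 0.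
    have [B1 B2 B3 B4] := proper_setD1 U1 vU.
    case: (adm_cut adm B1 B2 B3) => [[E _]|]; first by rewrite E inE eqxx in B4.
    rewrite (sum_setC1_cut adm vU ev) (@nrm_congr m m_gt0 _ (\sum_(v in U) s v)); last first.
      rewrite [in X in _ - X](big_setD1 v0) //= opprD addrCA subrr addr0 rpredN -nrm_eq0 //.
      by rewrite s0.
    have := adm_special adm; move: (\sum_(x in U) al x) (nrm m _) => p q; lia.
  exact: (step_remove below adm vU s0 al0 (u := v0)).
have [/exists_inP[w wU /and3P[wv wu evw]]|none] :=
    boolP [exists w in U, [&& w != v0, w != u & 0 < e v0 w]].
  by apply: (step_lift below adm str s0 uv _ _ uU vU wU); rewrite // 1?eq_sym // eC.
have ev y : y \in U -> y != u -> e v0 y = 0.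
  move=> yU yu; have [->|yv] := eqVneq y v0; first exact: adm_diag adm v0.
  apply: zero; move: none; rewrite negb_exists_in => /forall_inP /(_ y yU).
  by rewrite yv yu.
have [al0|al0] := eqVneq (al v0) 0; first exact: (step_remove below adm vU s0 al0 ev).
have par := adm_arcs_parity adm vU.
have [eps [eps1 epsP]] : exists eps : int, `|eps| = 1 /\ `|ka v0 - eps| <= al v0 - 1.
  move: kal al0 par; move: (ka v0) (al v0) => p q; clear.
  by case: (ltrP 0 p) => p0 h1 h2 h3; [exists 1 | exists (-1)]; split; lia.
by apply: (step_lift_arc below adm str s0 eps1 uv uU vU _ epsP); rewrite eC.
Qed.

(** By parity D = N + (||D|| - 2). Hence ||D|| is the absolute value of ||D|| - 2, so ||D|| = 1. *)
Lemma nrm_fixpoint (D : int) : 0 <= D -> D <= N - 2 + nrm m D -> N - 4 + nrm m D < D -> D = N - 1.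
Proof.
move=> D0 D1 D2; have := nrm_parity m_gt0 D; have := nrm_le m_gt0 D; have := nrm_ge0 m_gt0 D.
move=> n0 n1 np; have DE : D = 1 * N + (nrm m D - 2) by lia.
have := nrm_uniq m_gt0 1 (t := nrm m D - 2).
rewrite -DE; move: (nrm m D) n0 n1 np D1 D2 => p *; lia.
Qed.

Lemma step_regular U e al ka s v0 : (1 < #|U|)%N ->
  solved_below U e al -> admissible U e al ka s v0 -> strict U e al s ->
  (forall v, v \in U -> nrm m (s v) != 0) ->
  orientable N U e (fun v => s v - ka v).
Proof.
move=> U1 below adm str nz; have eC := adm_sym adm; have e0 := adm_ge0 adm.
pose D := \sum_(v in U) al v.
have Dle : D <= N - 2 + m%:Z by apply: le_trans (adm_special adm) _; rewrite lerD2l nrm_le.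
have [/exists_inP[x xU /exists_inP[y yU /and4P[xy exy /eqP sx /eqP sy]]]|nodel] := boolP
    [exists x in U, exists y in U, [&& x != y, 0 < e x y, nrm m (s x - 1) == nrm m (s x) - 1
      & nrm m (s y + 1) == nrm m (s y) - 1]].
  exact: (step_delete below adm str nz xy xU yU exy sx sy).
(* The edges within [U] connect it: otherwise two sides would each send at least N - 2 edges to z0,
   and 2(N - 2) exceeds the bound N - 2 + m because m > 2. *)
have two_sides A : A \subset U -> A != set0 -> A != U ->
    (forall x y, x \in A -> y \in U :\: A -> e x y = 0) -> False.
  move=> AU A0 AnU eA.
  have BU : U :\: A \subset U by rewrite subsetDl.
  have B0 : U :\: A != set0.
    by apply: contraNneq AnU => /eqP; rewrite setD_eq0 => UA; rewrite eqEsubset AU.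
  have BnU : U :\: A != U.
    have [z zA] := set0Pn _ A0; apply/eqP => E.
    by have := subsetP AU z zA; rewrite -E inE zA.
  have c1 := cut_nonexempt adm nz AU A0 AnU; have c2 := cut_nonexempt adm nz BU B0 BnU.
  have E1 : cut U e al A = \sum_(v in A) al v.
    by apply: eq_bigr => x xA; rewrite big1 ?add0r // => y; apply: eA.
  have E2 : cut U e al (U :\: A) = \sum_(v in U :\: A) al v.
    apply: eq_bigr => x xB; rewrite setDDr setDv set0U big1 ?add0r // => y.
    by rewrite inE => /andP[_ yA]; rewrite eC eA.
  have := sum_setD al AU; rewrite -/D -E1 -E2 => DE.
  have n1 := nrm_ge0 m_gt0 (\sum_(v in A) s v); have n2 := nrm_ge0 m_gt0 (\sum_(v in U :\: A) s v).
  move: c1 c2 n1 n2 Dle DE m_gt2; move: (nrm m _) (nrm m _) (cut _ _ _ _) (cut _ _ _ _) D.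
  clear; lia.
(* All targets have the same sign: by connectedness an edge would otherwise join [P] to the rest of
   [U], and it could be deleted. *)
have [eps [eps1 good]] : exists eps : int, `|eps| = 1 /\
    forall v, v \in U -> nrm m (s v - eps) = nrm m (s v) - 1.
  pose P := [set v in U | nrm m (s v - 1) == nrm m (s v) - 1].
  have PU : P \subset U by apply/subsetP => v; rewrite inE => /andP[].
  have neg v : v \in U -> v \notin P -> nrm m (s v + 1) = nrm m (s v) - 1.
    move=> vU; rewrite inE vU /= => /eqP nP.
    by case: (nrm_step m_gt0 (nz v vU)).
  have [P0|P0] := eqVneq P set0.
    exists (-1); split=> // v vU; rewrite opprK; apply: neg => //.
    by rewrite P0 inE.
  have [PE|PnU] := eqVneq P U.
    by exists 1; split=> // v; rewrite -{1}PE inE => /andP[_ /eqP].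
  case: (two_sides P PU P0 PnU) => x y xP; rewrite inE => /andP[yP yU].
  apply/eqP; rewrite eq_le e0 andbT leNgt; apply/negP => exy.
  have xU := subsetP PU x xP; move: nodel; rewrite negb_exists_in => /forall_inP /(_ x xU).
  rewrite negb_exists_in => /forall_inP /(_ y yU); rewrite exy neg // eqxx.
  move: xP; rewrite inE => /andP[_ ->]; rewrite !andbT negbK => /eqP xy.
  by move: yP; rewrite -xy inE xU => /negP; case; move: exy; rewrite xy (adm_diag adm).
have [/exists_inP[x xU kax]|noarc] := boolP [exists x in U, `|ka x - eps| <= al x - 1].
  exact: (step_arc below adm str nz eps1 xU kax (good x xU)).
(* No edge at z0 has the direction [eps], so all of them have the opposite one. *)
have kaE v : v \in U -> ka v = - (eps * al v).
  move=> vU; have := adm_arcs adm vU; have := adm_arcs_parity adm vU.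
  move: noarc; rewrite negb_exists_in => /forall_inP /(_ v vU); move: eps1.
  move: (ka v) (al v) => p q; clear => eps1.
  have [->|->] : eps = 1 \/ eps = -1 by lia.
    by rewrite mul1r; lia.
  by rewrite mulN1r; lia.
have sD : (N %| \sum_(v in U) s v + eps * D)%Z.
  have := adm_sum adm; rewrite (eq_bigr (fun v => s v + eps * al v)) => [|v vU].
    by rewrite big_split /= -mulr_sumr.
  by rewrite kaE // opprK.
have nD : nrm m (\sum_(v in U) s v) = nrm m D.
  have [e1|e1] : eps = 1 \/ eps = -1 by lia.
    rewrite -(nrmN m_gt0 D); apply: nrm_congr => //.
    by move: sD; rewrite e1 mul1r opprK.
  by apply: nrm_congr => //; move: sD; rewrite e1 mulN1r.
have D0 : 0 <= D.
  by apply: sumr_ge0 => v vU; apply: le_trans (adm_arcs adm vU).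
have [/exists_inP[x xU /exists_inP[y yU /andP[xy exy]]]|noedge] :=
    boolP [exists x in U, exists y in U, (x != y) && (0 < e x y)]; last first.
  have [z zU] : exists z, z \in U by apply/set0Pn; rewrite -card_gt0; lia.
  have [B1 B2 B3 _] := proper_setD1 U1 zU.
  case: (two_sides _ B1 B2 B3) => x y; rewrite !inE => /andP[xz xU].
  rewrite negb_and negbK => /andP[/orP[/eqP->|/negbTE->] // _].
  move: noedge; rewrite negb_exists_in => /forall_inP /(_ x xU).
  rewrite negb_exists_in => /forall_inP /(_ z zU); rewrite xz /= => h.
  by apply/eqP; rewrite eq_le e0 andbT leNgt.
(* If z0 has room for two more edges, an edge is rerouted through it; otherwise its degree is N -
   1. *)
case: (lerP D (N - 4 + nrm m (\sum_(v in U) s v))) => loose.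
  exact: (step_reroute below adm xy xU yU exy loose).
have DE : D = N - 1.
  by apply: nrm_fixpoint => //; rewrite -nD //; apply: adm_special adm.
by apply: (step_concentrate below adm str nz eps1 xy xU yU exy (good x xU) DE); rewrite -DE.
Qed.

Theorem modulo_orientation U e al ka s v0 : admissible U e al ka s v0 ->
  orientable N U e (fun v => s v - ka v).
Proof.
have [n] := ubnP (absz (weight U e)); have [d] := ubnP (absz (\sum_(v in U) al v)).
elim: n d U e al ka s v0 => // n IHn d; elim: d => // d IHd U e al ka s v0 Dd Wn adm.
have weight_ge0 U' e' : (forall x y, 0 <= e' x y) -> 0 <= weight U' e'.
  by move=> h; rewrite addr_ge0 // sumr_ge0 // => x _; apply: sumr_ge0.
have special_ge0 U' e' al' ka' s' v1 : admissible U' e' al' ka' s' v1 -> 0 <= \sum_(v in U') al' v.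
  by move=> adm'; apply: sumr_ge0 => v vU; apply: le_trans (adm_arcs adm' vU).
have below : solved_below U e al.
  move=> U' e' al' ka' s' v1 adm'.
  have W0 := weight_ge0 U _ (adm_ge0 adm); have W1 := weight_ge0 U' _ (adm_ge0 adm').
  have S0 := special_ge0 _ _ _ _ _ _ adm; have S1 := special_ge0 _ _ _ _ _ _ adm'.
  case=> [lt|[eqw lt]].
    apply: (IHn (absz (\sum_(v in U') al' v)).+1) adm' => //.
    by move: (weight U e) (weight U' e') Wn W0 W1 lt; clear; lia.
  apply: IHd adm'; last by rewrite eqw.
  by move: (\sum_(v in U) al v) (\sum_(v in U') al' v) Dd S0 S1 lt; clear; lia.
case: (leqP #|U| 1) => U1; first exact: step_small adm U1.
have [/existsP[A /and4P[AU A1 AnU tight]]|notight] := boolP [exists A : {set V},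
    [&& A \subset U, (1 < #|A|)%N, A != U & cut U e al A <= N - 2 + nrm m (\sum_(v in A) s v)]].
  exact: (step_contract below adm AU A1 AnU tight).
have str : strict U e al s.
  move=> A AU A1 AnU; apply: (cut_strict adm AU); rewrite ltNge.
  by apply: contra notight => h; apply/existsP; exists A; rewrite AU A1 AnU.
have [/exists_inP[v vU /eqP sv]|nz] := boolP [exists v in U, nrm m (s v) == 0].
  have [v0P|v0P] := boolP ((v0 \in U) && (nrm m (s v0) == 0)).
    by case/andP: v0P => v0U /eqP s0; apply: (step_exempt U1 below adm str v0U s0).
  (* The exemption of [v0] is void in this case and can be passed on to [v]. *)
  have adm' : admissible U e al ka s v.
    case: adm => ? ? ? ? ? ? ? ? cutP; split=> // A AU A0 AnU; right.
    case: (cutP A AU A0 AnU) => [[AE s0]|//].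
    by case/negP: v0P; rewrite s0 eqxx (subsetP AU) // AE inE.
  exact: (step_exempt U1 below adm' str vU sv).
apply: (step_regular U1 below adm str) => v vU.
by move: nz; rewrite negb_exists_in => /forall_inP /(_ v vU).
Qed.

End Admissible.

(** * Antisymmetric flows *)

Lemma sum_setT (T : finType) (F : T -> int) : \sum_(a in [set: T]) F a = \sum_a F a.
Proof. by apply: eq_bigl => a; rewrite inE. Qed.

Section Digraph.
Variables (V E : finType) (tail head : E -> V).
Hypothesis noloop : forall a : E, tail a != head a.
Implicit Types (x y v : V) (A : {set V}) (B : {set E}).

Local Notation aedge a := (edge_ind (tail a) (head a)).
Local Notation aarc a := (arc_ind (tail a) (head a)).

Lemma edge_ge0 (u w x y : V) : 0 <= edge_ind u w x y.
Proof. by rewrite /edge_ind /ind addr_ge0 ?mulr_ge0. Qed.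

Lemma edge_eq1 (u w x y : V) : u != w -> edge_ind u w x y != 0 ->
  (x = u /\ y = w) \/ (x = w /\ y = u).
Proof.
rewrite /edge_ind /ind => uw; case: (x =P u) => xu; case: (y =P w) => yw;
  case: (x =P w) => xw; case: (y =P u) => yu //= _; by [left | right].
Qed.

(** Parallel and opposite arcs share one value of [g]. It is distributed by taking off one arc at a
    time with [split_step]; [j a] is counted in the direction of [a]. *)
Lemma split_arcs (c : int) B (g : V -> V -> int) : 0 <= c ->
  (forall x y, g y x = - g x y) ->
  (forall x y, `|g x y| <= c * \sum_(a in B) aedge a x y) ->
  (forall x y, (2 %| g x y - c * \sum_(a in B) aedge a x y)%Z) ->
  exists j : E -> int, [/\ forall a, a \in B -> `|j a| <= c,
    forall a, a \in B -> (2 %| j a - c)%Z &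
    forall x y, g x y = \sum_(a in B) j a * aarc a x y].
Proof.
move=> c0; have [n] := ubnP #|B|; elim: n B g => // n IHn B g.
have [->|[a aB]] := set_0Vmem B.
  move=> _ gA gB _; exists (fun=> 0); split=> [a|a|x y]; rewrite ?inE //.
  by have := gB x y; rewrite !big_set0 mulr0 normr_le0 => /eqP.
rewrite (cardsD1 a) aB ltnS => cB gA gB gP.
pose S := \sum_(b in B :\ a) aedge b (tail a) (head a).
have S0 : 0 <= S by apply: sumr_ge0 => b _; apply: edge_ge0.
have a1 : aedge a (tail a) (head a) = 1 /\ aarc a (tail a) (head a) = 1.
  by rewrite /edge_ind /arc_ind /ind !eqxx (negbTE (noloop a)) mul0r.
have [h1 h2] : `|g (tail a) (head a)| <= c + c * S /\ (2 %| g (tail a) (head a) - (c + c * S))%Z.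
  have := gB (tail a) (head a); have := gP (tail a) (head a).
  by rewrite (big_setD1 a aB) /= a1.1 -/S mulrDr mulr1.
have [t [t1 t2 t3]] := split_step c0 (mulr_ge0 c0 S0) h1 h2.
have par : (2 %| g (tail a) (head a) - t - c * S)%Z.
  have -> : g (tail a) (head a) - t - c * S = (g (tail a) (head a) - (c + c * S)) - (t - c) by ring.
  exact: rpredB.
have SC x y : \sum_(b in B :\ a) aedge b x y = \sum_(b in B :\ a) aedge b y x.
  by apply: eq_bigr => b _; apply: edgeC.
pose g' x y := g x y - t * aarc a x y.
have g'A x y : g' y x = - g' x y by rewrite /g' gA (arcC _ _ x y); ring.
have g'E x y : (aedge a x y = 0 /\ g' x y = g x y) \/
    `|g' x y| = `|g (tail a) (head a) - t| /\ (x = tail a /\ y = head a \/ x = head a /\ y = tail a).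
  have [e0|e1] := eqVneq (aedge a x y) 0.
    left; split=> //; rewrite /g'; case: (edge_arc x y (noloop a)) => [[_ ->]|[]]; last by rewrite e0.
    by rewrite mulr0 subr0.
  right; case: (edge_eq1 (noloop a) e1) => -[-> ->]; split; auto; last rewrite g'A normrN;
  by rewrite /g' a1.2 mulr1.
have [||| j [j1 j2 j3]] := IHn (B :\ a) g' _ g'A.
- by lia.
- move=> x y; case: (g'E x y) => [[e0 ->]|[-> xy]].
    by have := gB x y; rewrite (big_setD1 a aB) /= e0 add0r.
  by case: xy => -[-> ->]; rewrite // SC.
- have par' x y : (2 %| g' x y - c * \sum_(b in B :\ a) aedge b x y)%Z ->
      (2 %| g' y x - c * \sum_(b in B :\ a) aedge b y x)%Z.
    rewrite (g'A x y) (SC x y); move: (c * _) (g' x y) => p q; lia.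
  move=> x y; case: (g'E x y) => [[e0 ->]|[_ xy]].
    by have := gP x y; rewrite (big_setD1 a aB) /= e0 add0r.
  have base : (2 %| g' (tail a) (head a) - c * \sum_(b in B :\ a) aedge b (tail a) (head a))%Z.
    by rewrite /g' a1.2 mulr1.
  by case: xy => -[-> ->] //; apply: par'.
exists (fun b => if b == a then t else j b); split.
- by move=> b bB; case: eqVneq => // ba; apply: j1; rewrite !inE ba.
- by move=> b bB; case: eqVneq => // ba; apply: j2; rewrite !inE ba.
move=> x y; rewrite (big_setD1 a aB) /= eqxx.
rewrite (eq_bigr (fun b => j b * aarc b x y)) => [|b]; last by rewrite !inE => /andP[/negbTE->].
by rewrite -j3 /g' addrC subrK.
Qed.

(** Without the edges across it, [A] is closed under adjacency, so no path leads from [A] to its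
    complement. *)
Lemma cut_size (lambda : nat) A : edge_connected tail head lambda -> A != set0 -> A != setT ->
  (lambda <= #|[set a | (tail a \in A) != (head a \in A)]|)%N.
Proof.
move=> conn /set0Pn[x xA] AnT; set F := [set a | _].
have [y yA] : exists y, y \notin A.
  apply/existsP; move: AnT; apply: contraNT; rewrite negb_exists => /forallP h.
  by apply/eqP/setP => y; rewrite inE; have := h y; rewrite negbK.
rewrite leqNgt; apply/negP => /conn /(_ x y) /closed_connect -/(_ (mem A)).
rewrite xA (negbTE yA) => h; suff : true = false by []; apply: h.
move=> u w /existsP[a /andP[]]; rewrite inE negbK => /eqP tha.
by case/orP => /andP[/eqP <- /eqP <-].
Qed.

Lemma sum_cut (A : {set V}) :
  \sum_(a : E) ((tail a \in A)%:Z * (head a \notin A)%:Z + (head a \in A)%:Z * (tail a \notin A)%:Z)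
  = #|[set a | (tail a \in A) != (head a \in A)]|%:Z.
Proof.
rewrite -sum1_card (big_morph Posz PoszD (erefl 0%:Z)) [RHS]big_mkcond /=.
apply: eq_bigr => a _; rewrite inE.
by case: (tail a \in A); case: (head a \in A).
Qed.

Lemma sum_tail (R : pzRingType) (F : E -> int) (t : E -> V) v :
  \sum_(a | t a == v) (F a)%:~R = (\sum_a F a * ind (t a) v)%:~R :> R.
Proof.
rewrite rmorph_sum big_mkcond /=; apply: eq_bigr => a _.
by rewrite /ind eq_sym; case: eqP; rewrite ?mulr1 ?mulr0.
Qed.
End Digraph.

Lemma ceil_div_mul (a b : nat) : (0 < b)%N -> (a <= b * ceil_div a b)%N.
Proof.
move=> b0; have := ltn_ceil (a + b - 1) b0; rewrite mulSn /ceil_div (mulnC b).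
by move: (_ %/ _ * _)%N => q; lia.
Qed.

Theorem theorem12 (k : nat) (hk : (2 <= k)%N)
  (V E : finType) (tail head : E -> V)
  (noloop : forall e : E, tail e != head e) :
  edge_connected tail head (ceil_div (6 * k) (k - 1)) ->
  exists f : E -> 'Z_(2 * k + 1),
    is_flow tail head f /\ antisym_flow f.
Proof.
move=> conn; pose m := (2 * k + 1)%N.
(* Without arcs the zero map is a flow; otherwise an arc supplies a vertex to be named as [v0]. *)
case: (pickP (@predT E)) => [a0 _|noE]; last first.
  exists (fun=> 0); split=> [v|a]; last by have := noE a.
  by rewrite !big1 ?subrr.
pose c : int := k%:Z - 1.
pose e x y : int := c * \sum_(a in [set: E]) edge_ind (tail a) (head a) x y.
pose s v : int := - (k%:Z + 1) * \sum_a (ind (tail a) v - ind (head a) v).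
have c0 : 0 <= c by rewrite /c; lia.
have eC x y : e x y = e y x by congr (_ * _); apply: eq_bigr => a _; apply: edgeC.
have e0 x : e x x = 0 by rewrite /e big1 ?mulr0 // => a _; apply: edge_diag.
have par v : v \in [set: V] -> (2 %| s v - (\sum_(y in [set: V]) e v y + 0))%Z.
  move=> _; rewrite addr0 /e -mulr_sumr exchange_big /= sum_setT /s !mulr_sumr -sumrB.
  apply: rpred_sum => a _; rewrite sum_edge !inE !mulr1.
  apply/dvdzP; exists (ind (head a) v - k%:Z * ind (tail a) v); rewrite /c; ring.
(* At the start z0 is an isolated vertex. *)
have adm : admissible m [set: V] e (fun=> 0) (fun=> 0) s (tail a0).
  split=> //.
  - by move=> x y; rewrite mulr_ge0 // sumr_ge0 // => a _; apply: edge_ge0.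
  - rewrite sum_setT; under eq_bigr do rewrite subr0.
    rewrite /s -mulr_sumr exchange_big /= big1 ?mulr0 ?dvdz0 // => a _.
    by rewrite sumrB -!sum_setT !sum_ind !inE subrr.
  - by rewrite big1_eq; have := nrm_ge0 (m := m) (ltac:(lia)) (\sum_(v in [set: V]) s v); lia.
  move=> A AT A0 AnT; right.
  (* At most 4k + (2k+1) = 6k+1 edges are required, one more than connectivity gives. All 6k+1 are
     required only if the norm is 2k+1, and then parity makes the cut odd. *)
  have := cut_parity eC e0 par AT.
  have -> : cut [set: V] e (fun=> 0) A = c * #|[set a | (tail a \in A) != (head a \in A)]|%:Z.
    rewrite -sum_cut /cut /e; under eq_bigr do rewrite addr0 -mulr_sumr exchange_big /=.
    rewrite -mulr_sumr exchange_big /= sum_setT; congr (_ * _); apply: eq_bigr => a _.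
    by rewrite sum2_edge !inE !andbT.
  have := cut_size conn A0 AnT.
  have := ceil_div_mul (6 * k) (b := k - 1) (ltac:(lia)).
  set L := ceil_div _ _; set n := #|_|; set z := \sum_(v in A) s v.
  have := nrm_le (m := m) (ltac:(lia)) z; have := nrm_parity (m := m) (ltac:(lia)) z.
  move: (nrm m z) => p p2 pm L1 L2.
  have {L1 L2} : 6 * k%:Z <= c * n%:Z.
    have : ((k - 1) * L <= (k - 1) * n)%N by rewrite leq_mul2l L2 orbT.
    by rewrite /c; nia.
  move: (c * n%:Z) p2 pm; rewrite /m; clear; lia.
have m_gt2 : (2 < m)%N by rewrite /m; lia.
have [g [gA gB gP gS]] := modulo_orientation m_gt2 adm.
have [j [j1 j2 j3]] : exists j : E -> int, [/\ forall a, a \in [set: E] -> `|j a| <= c,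
    forall a, a \in [set: E] -> (2 %| j a - c)%Z &
    forall x y, g x y = \sum_(a in [set: E]) j a * arc_ind (tail a) (head a) x y].
  by apply: split_arcs => // x y; [apply: gB | apply: gP].
pose F a : int := k%:Z + 1 + j a.
exists (fun a => (F a)%:~R); split=> [v|a b].
  have -> : \sum_(a | tail a == v) (F a)%:~R - \sum_(a | head a == v) (F a)%:~R =
    (\sum_a F a * ind (tail a) v - \sum_a F a * ind (head a) v)%:~R :> 'Z_(2 * k + 1).
    by rewrite !sum_tail rmorphB.
  have -> : \sum_a F a * ind (tail a) v - \sum_a F a * ind (head a) v =
    \sum_(y in [set: V]) g v y - (s v - 0).
    under [\sum_(y in _) _]eq_bigr do rewrite j3.
    rewrite exchange_big /= sum_setT /s subr0 mulNr opprK mulr_sumr -sumrB -big_split /=.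
    by apply: eq_bigr => a _; rewrite -mulr_sumr sum_arc !inE !mulr1 /F; ring.
  (* The targets are met modulo 2(2k+1), which vanishes in ['Z_(2 * k + 1)]. *)
  have /dvdzP[q ->] := gS v (in_setT v).
  rewrite PoszM mulrA rmorphM /= [X in _ * X](_ : _ = 0) ?mulr0 //.
  by rewrite -pmulrn; apply: (@pchar_Zp (2 * k + 1)); lia.
have := j1 a (in_setT a); have := j2 a (in_setT a).
have := j1 b (in_setT b); have := j2 b (in_setT b).
rewrite /c => b2 b1 a2 a1 /eqP; rewrite -addr_eq0 -rmorphD /=.
(* Both values lie in {2, 4, ..., 2k}, so n is between 2 and 2k, and the odd number 2k+1 cannot
   divide 2n. *)
have [n [-> n0 n1]] : exists n : nat, [/\ F a + F b = (2 * n)%N%:Z, (0 < n)%N & (n < 2 * k + 1)%N].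
  exists (absz ((F a + F b) %/ 2)%Z); rewrite /F; split; lia.
rewrite -pmulrn => /eqP /(congr1 val) /=; rewrite val_Zp_nat; last by lia.
move=> h; have : (2 * k + 1 %| 2 * n)%N by apply/eqP.
rewrite Gauss_dvdr; last by rewrite coprimen2 addn1 oddS mul2n odd_double.
by move=> /dvdn_leq; lia.
Qed.
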